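(* Let $P(\lambda)=\sum_{i=0}^m\lambda^iA_i$, $A_i\in\mathbb{C}^{n\times n}$, be a matrix polynomial of normal rank $r<n$ with simple eigenvalue $\lambda_0\in\mathbb{C}$, and let $[X\ x]$, $[Y\ y]$ be orthonormal bases of $\ker P(\lambda_0)$, $\ker(P(\lambda_0)^* )$ as in the context. Let $E\sim\mathcal{U}(2N)$, $N=n^2(m+1)$, be a random perturbation $E(\lambda)=\sum_{i=0}^m\lambda^iE_i$. Let $a$ and $b$ be left and right eigenvectors of norm $1$, corresponding to a (finite) eigenvalue $\zeta$, of the pencil $$[Y\ y]^*E(\lambda_0)[X\ x]+\zeta\cdot[Y\ y]^*P'(\lambda_0)[X\ x],$$ let $\overline{x}=[X\ x]\,b$, $\overline{y}=[Y\ y]\,a$, and define $$\overline{\gamma}_P=|\overline{y}^*P'(\lambda_0)\overline{x}|\Big(\sum_{j=0}^m|\lambda_0|^{2j}\Big)^{-1/2},\qquad \gamma_P=|y^*P'(\lambda_0)x|\Big(\sum_{j=0}^m|\lambda_0|^{2j}\Big)^{-1/2}.$$ Then for every $0<t\le1$, $$\mathbb{P}(\overline{\gamma}_P<\gamma_P\cdot t)\le 2t(n-r).$$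
   Context: Let $P(\lambda)=\sum_{i=0}^m\lambda^iA_i$, $A_i\in\mathbb{C}^{n\times n}$. Its normal rank is $r=\max_{\lambda\in\mathbb{C}}\operatorname{rank}P(\lambda)$. A number $\lambda_0\in\mathbb{C}$ is a (finite) eigenvalue if $\operatorname{rank}P(\lambda_0)<r$; it is simple if, in the Smith canonical form of $P$, exactly one of the nonzero invariant polynomials vanishes at $\lambda_0$, and it has a simple zero there. Then $\dim\ker P(\lambda_0)=n-r+1$. Singular spaces. Let $\mathcal{N}(P)=\{x(\lambda)\in\mathbb{C}(\lambda)^n: P(\lambda)x(\lambda)\equiv0\}$ and $\mathcal{N}_*(P)=\{y(\lambda)\in\mathbb{C}(\overline\lambda)^n: y(\lambda)^*P(\lambda)\equiv0\}$; both have dimension $n-r$. A minimal basis is a polynomial basis whose sum of column degrees is minimal among all polynomial bases. If $[x_1(\lambda),\dots,x_{n-r}(\lambda)]$ and $[y_1(\lambda),\dots,y_{n-r}(\lambda)]$ are minimal bases of $\mathcal{N}(P)$ and $\mathcal{N}_*(P)$, set $\ker_{\lambda_0}(P)=\operatorname{range}[x_1(\lambda_0),\dots,x_{n-r}(\lambda_0)]$ and $\ker_{\lambda_0}(P^* )=\operatorname{range}[y_1(\lambda_0),\dots,y_{n-r}(\lambda_0)]$. Bases. $[X\ x]$ and $[Y\ y]$ in $\mathbb{C}^{n\times(n-r+1)}$ have orthonormal columns and are bases of $\ker P(\lambda_0)$ and $\ker(P(\lambda_0)^* )$ respectively, such that the columns of $X\in\mathbb{C}^{n\times(n-r)}$ form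 a basis of $\ker_{\lambda_0}(P)$ and those of $Y\in\mathbb{C}^{n\times(n-r)}$ a basis of $\ker_{\lambda_0}(P^* )$. $E\sim\mathcal{U}(2N)$ means that the vectorization of $[E_0\ E_1\ \cdots\ E_m]$, $E_i\in\mathbb{C}^{n\times n}$, is uniformly distributed on the unit sphere of $\mathbb{C}^{N}$, $N=n^2(m+1)$. For a pencil $G+\zeta H$, an eigenvalue $\zeta$ has left and right eigenvectors $a,b\neq0$ if $a^*(G+\zeta H)=0$ and $(G+\zeta H)b=0$. Almost surely, $[Y\ y]^*E(\lambda_0)[X\ x]$ is nonsingular and the pencil in the claim is regular with a finite eigenvalue. *)

(* Defs.v *)
From HB Require Import structures.
From mathcomp Require Import all_boot all_order all_algebra.
From mathcomp Require Import spectral fraction complex.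
From mathcomp Require Import all_classical all_reals all_analysis.

Set Implicit Arguments.
Unset Strict Implicit.
Unset Printing Implicit Defensive.

Import Order.TTheory GRing.Theory Num.Theory.
Import ComplexField Normc.

Local Open Scope classical_set_scope.
Local Open Scope ring_scope.
Local Open Scope sesquilinear_scope.

Section ColumnBases.
Variable F : fieldType.

Definition col_range n k (Z : 'M[F]_(n, k)) : set 'cV[F]_n :=
  range (fun c : 'cV[F]_k => Z *m c).

Definition col_basis n k (V : set 'cV[F]_n) (Z : 'M[F]_(n, k)) : Prop :=
  row_free Z^T /\ col_range Z = V.

End ColumnBases.

Section MatrixPolynomials.
Variable R : realType.
Notation C := R[i].
Notation ratfun := {fraction {poly C}}.

(* sum_i lambda^i A_i, as a matrix with polynomial entries *)
Definition matpoly m n (A : 'I_m.+1 -> 'M[C]_n) : 'M[{poly C}]_n :=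
  \sum_(i < m.+1) 'X^i *: map_mx polyC (A i).

Definition mpeval n k (Q : 'M[{poly C}]_(n, k)) (lam : C) : 'M[C]_(n, k) :=
  map_mx (fun p => p.[lam]) Q.

Definition mpderiv n k (Q : 'M[{poly C}]_(n, k)) : 'M[{poly C}]_(n, k) :=
  map_mx (@deriv C) Q.

Definition mpfrac n k (Q : 'M[{poly C}]_(n, k)) : 'M[ratfun]_(n, k) :=
  map_mx (@tofrac {poly C}) Q.

Definition normal_rank n (Q : 'M[{poly C}]_n) (r : nat) : Prop :=
  (exists mu, \rank (mpeval Q mu) = r) /\
  (forall mu, \rank (mpeval Q mu) <= r)%N.

Definition is_eigenvalue n (Q : 'M[{poly C}]_n) (lam : C) : Prop :=
  exists2 r, normal_rank Q r & (\rank (mpeval Q lam) < r)%N.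

(* Membership in unitmx over {poly C} is unimodularity.  The nonzero invariant
   polynomials come first, since 0 divides only 0. *)
Definition smith_form n (Q : 'M[{poly C}]_n) (d : 'I_n -> {poly C}) : Prop :=
  [/\ forall i, d i != 0 -> d i \is monic,
      forall i j : 'I_n, (i <= j)%N -> d i %| d j
    & exists U V : 'M[{poly C}]_n,
        [/\ U \in unitmx, V \in unitmx
          & U *m Q *m V = diag_mx (\row_i d i)]].

Definition simple_eigenvalue n (Q : 'M[{poly C}]_n) (lam : C) : Prop :=
  is_eigenvalue Q lam /\
  exists d, smith_form Q d /\
    exists i, [/\ d i != 0, root (d i) lam, mup lam (d i) = 1%N
                & forall j, d j != 0 -> root (d j) lam -> j = i].

Definition nullspace n (Q : 'M[{poly C}]_n) : set 'cV[ratfun]_n :=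
  [set x | mpfrac Q *m x = 0].

(* the field automorphism of C(X) conjugating the coefficients *)
Definition conj_ratfun (f : ratfun) : ratfun :=
  let: (p, q) := frac (repr f) in
  tofrac (map_poly Num.conj p) / tofrac (map_poly Num.conj q).

(* An element y(lambda) of C(conj lambda)^n is represented by the vector w over
   C(X) with y(lambda) = w(conj lambda); then y(lambda)^* is the row of rational
   functions of lambda got by transposing w and conjugating coefficients. *)
Definition lnullspace n (Q : 'M[{poly C}]_n) : set 'cV[ratfun]_n :=
  [set w | (map_mx conj_ratfun w)^T *m mpfrac Q = 0].

Definition coldeg n k (Z : 'M[{poly C}]_(n, k)) (j : 'I_k) : nat :=
  \max_(i < n) (size (Z i j)).-1.

Definition minimal_basis n k (V : set 'cV[ratfun]_n)
    (Z : 'M[{poly C}]_(n, k)) : Prop :=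
  col_basis V (mpfrac Z) /\
  forall Z' : 'M[{poly C}]_(n, k), col_basis V (mpfrac Z') ->
    (\sum_j coldeg Z j <= \sum_j coldeg Z' j)%N.

(* ker_lam(Q); the range does not depend on the choice of minimal basis *)
Definition ker_at n (Q : 'M[{poly C}]_n) (lam : C) : set 'cV[C]_n :=
  [set v | exists k (Z : 'M[{poly C}]_(n, k)),
     minimal_basis (nullspace Q) Z /\ col_range (mpeval Z lam) v].

(* ker_lam(Q^* ); Z is a polynomial in conj lambda, see lnullspace *)
Definition lker_at n (Q : 'M[{poly C}]_n) (lam : C) : set 'cV[C]_n :=
  [set v | exists k (Z : 'M[{poly C}]_(n, k)),
     minimal_basis (lnullspace Q) Z /\ col_range (mpeval Z (Num.conj lam)) v].

Definition orthonormal_cols n k (Z : 'M[C]_(n, k)) : Prop :=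
  Z^t* *m Z = 1%:M.

Definition hnorm n (v : 'cV[C]_n) : R :=
  Num.sqrt (\sum_i normc (v i 0) ^+ 2).

Definition pencil n (G H : 'M[C]_n) : 'M[{poly C}]_n :=
  map_mx polyC G + 'X *: map_mx polyC H.

Definition unit_eigenvectors n (G H : 'M[C]_n) (zeta : C) (a b : 'cV[C]_n) :
    Prop :=
  [/\ is_eigenvalue (pencil G H) zeta,
      a^t* *m (G + zeta *: H) = 0, (G + zeta *: H) *m b = 0,
      hnorm a = 1 & hnorm b = 1].

Definition gammaP m n (A : 'I_m.+1 -> 'M[C]_n) (lam : C) (y x : 'cV[C]_n) : R :=
  normc ((y^t* *m mpeval (mpderiv (matpoly A)) lam *m x) 0 0) *
  (Num.sqrt (\sum_(j < m.+1) normc lam ^+ (2 * j)))^-1.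

End MatrixPolynomials.

Section UniformSphere.
Variable R : realType.

(* Lebesgue measure of Borel subsets of R^d, as an iterated integral *)
Fixpoint lebesgue_tuple (d : nat) : set (d.-tuple R) -> \bar R :=
  match d with
  | 0 => fun A => \d_([tuple] : 0.-tuple R) A
  | d'.+1 => fun A =>
      (\int[@lebesgue_measure R]_x
         @lebesgue_tuple d' [set v : d'.-tuple R | A (cons_tuple (x : R) v)])%E
  end.

Definition enorm d (v : d.-tuple R) : R :=
  Num.sqrt (\sum_(i < d) tnth v i ^+ 2).

Definition cone d (A : set (d.-tuple R)) : set (d.-tuple R) :=
  [set v | 0 < enorm v <= 1 /\ A [tuple (enorm v)^-1 * tnth v i | i < d]].

(* Normalized surface measure of the unit sphere of R^d: A is assigned the
   proportion of the unit ball lying in the cone over A. *)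
Definition uniform_sphere d disp (T : measurableType disp) (P : probability T R)
    (V : T -> d.-tuple R) : Prop :=
  measurable_fun setT V /\
  forall A : set (d.-tuple R), measurable A ->
    P (V @^-1` A) =
    (fine (lebesgue_tuple (cone A)) / fine (lebesgue_tuple (cone [set: d.-tuple R])))%:E.

(* real coordinates of the vectorization of [E_0 ... E_m], indexed by the block,
   the column, the row, and the choice of real or imaginary part *)
Definition coord m n : finType := ('I_m.+1 * 'I_n * 'I_n * bool)%type.

Lemma card_coord m n : #|coord m n| = (2 * (n ^ 2 * m.+1))%N.
Proof. by rewrite !card_prod !card_ord card_bool mulnC -mulnA (mulnC m.+1). Qed.

Definition realvec m n (E : 'I_m.+1 -> 'M[R[i]]_n) : #|coord m n|.-tuple R :=
  codom_tuple (fun c : coord m n =>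
    let: (i, k, j, re) := c in
    if re then complex.Re (E i j k) else complex.Im (E i j k)).

End UniformSphere.

(* Main.v *)
(* Because [X] and [Y] span the singular spaces, differentiating P(l) x(l) = 0
   shows that [Y y]^* P'(l0) [X x] has a single nonzero entry, the last one.
   Hence gammabar = gamma |a_last| |b_last|, and gammabar < gamma t forces
   |a_last|^2 < t or |b_last|^2 < t.  The vector b is the normalized last row of
   cofactors of G = [Y y]^* E(l0) [X x], and the law of G is invariant under left
   and right multiplication by unitary matrices; so |b_last|^2 is distributed
   like the squared modulus of one coordinate of a uniform unit vector of
   C^(n-r+1), and is below t with probability 1 - (1 - t)^(n-r) <= t (n-r). *)
Require Import Defs.
From HB Require Import structures.
From mathcomp Require Import all_boot all_order all_algebra.
From mathcomp Require Import perm spectral fraction complex.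
From mathcomp Require Import all_classical all_reals all_analysis.
From mathcomp Require Import measurable_realfun ring lra.

Set Implicit Arguments.
Unset Strict Implicit.
Unset Printing Implicit Defensive.

Import Order.TTheory GRing.Theory Num.Theory.
Import ComplexField.

Local Open Scope classical_set_scope.
Local Open Scope ring_scope.
Local Open Scope sesquilinear_scope.

(** * Lebesgue measure on tuples *)

(** The eigenvalue and its eigenvectors are an arbitrary choice depending on [E], with no law of
    their own, so no event about them can be estimated directly. Linear algebra removes them: the
    derivative term of the pencil touches a single entry, hence every other row of [G] annihilates
    [b] whatever [zeta] is, and generically these rows determine [b] up to a scalar. The event is
    thus covered by two events about [G] alone and two null sets: the exceptional set of the almost
    sure hypothesis, and the zero set of the corner minor, off which the cofactor vector is nonzero.
    The conjugate transpose of [G] serves [a] in the same way, and the union bound is the origin of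
    the factor 2.

    The law of the normalized cofactor vector is never constructed. Its invariance is used on one
    family of events, written without quotients, by averaging over directions in the unit ball; so
    only volumes have to be computed, never surface measures. As volume is an iterated integral
    here, its invariance under isometries is itself derived from translations and scalings of the
    line. *)

Section LebesgueTuple.
Variable R : realType.
Local Notation mu := (@lebesgue_measure R).
Local Notation leb d := (@lebesgue_tuple R d).

Definition conspair d (p : R * d.-tuple R) : d.+1.-tuple R := cons_tuple p.1 p.2.

Lemma measurable_conspair d : measurable_fun setT (@conspair d).
Proof. exact: measurable_cons. Qed.

Section ConsMeasure.
Variables (d : nat) (m : {sigma_finite_measure set (d.-tuple R) -> \bar R}).

(** As a pushforward of a product measure it inherits sigma-additivity, while [cons_measureE]
    identifies it with the recursive clause of [lebesgue_tuple]. *)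
Definition cons_measure : set (d.+1.-tuple R) -> \bar R :=
  pushforward (mu \x m)%E (@conspair d).

Lemma cons_measureE A :
  cons_measure A = (\int[mu]_x m [set v | A (cons_tuple x v)])%E.
Proof.
apply: eq_integral => x _ /=; congr (m _).
by apply/seteqP; split => v; rewrite /xsection/= inE.
Qed.

Let cons_measure0 : cons_measure set0 = 0%E.
Proof. by rewrite /cons_measure /pushforward preimage_set0 measure0. Qed.

Let cons_measure_ge0 A : (0 <= cons_measure A)%E.
Proof. exact: (measure_ge0 (mu \x m)%E). Qed.

Let cons_measure_sigma_additive : semi_sigma_additive cons_measure.
Proof.
move=> F mF tF mUF; rewrite /cons_measure /pushforward preimage_bigcup.
apply: measure_semi_sigma_additive.
- by move=> n; rewrite -[_ @^-1` _]setTI; exact: measurable_conspair.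
- apply/trivIsetP => /= i j _ _ ij; rewrite -preimage_setI.
  by move/trivIsetP : tF => /(_ _ _ _ _ ij) ->//; rewrite preimage_set0.
- by rewrite -preimage_bigcup -[_ @^-1` _]setTI; exact: measurable_conspair.
Qed.

HB.instance Definition _ := isMeasure.Build _ _ _ cons_measure
  cons_measure0 cons_measure_ge0 cons_measure_sigma_additive.

Let cons_measure_sigma_finite : sigma_finite setT cons_measure.
Proof.
have /sigma_finiteP[F [TF ndF Foo]] := sigma_finiteT mu.
have /sigma_finiteP[G [TG ndG Goo]] := sigma_finiteT m.
(* Both exhaustions are nondecreasing, so the larger of two indices serves head and tail
   together. *)
exists (fun n => [set v | F n (thead v) /\ G n [tuple of behead v]]).
  rewrite predeqE => v; split=> // _.
  have [k _ Fk] : (\bigcup_k F k) (thead v) by rewrite -TF.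
  have [l _ Gl] : (\bigcup_k G k) [tuple of behead v] by rewrite -TG.
  exists (maxn k l) => //; split.
    by move: Fk; exact/subsetPset/ndF/leq_maxl.
  by move: Gl; exact/subsetPset/ndG/leq_maxr.
move=> k; have [mF Ffin] := Foo k; have [mG Gfin] := Goo k.
split.
  apply: measurableI; rewrite -[X in measurable X]setTI.
    by apply: measurable_tnth.
  by apply: measurable_behead.
rewrite /cons_measure /pushforward (_ : _ @^-1` _ = F k `*` G k).
  by rewrite product_measure1E// lte_mul_pinfty// ge0_fin_numE.
apply/seteqP; split=> -[x v] /=; rewrite /conspair/=.
  by rewrite (_ : [tuple of _] = v)//; exact: val_inj.
by rewrite (_ : [tuple of _] = v)//; exact: val_inj.
Qed.

HB.instance Definition _ := Measure_isSigmaFinite.Build _ _ _ cons_measure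
  cons_measure_sigma_finite.

End ConsMeasure.

(** The induction runs over bundled measures because the product needs sigma-finiteness one
    dimension lower; the equation then transports the axioms to [lebesgue_tuple] itself. *)
Lemma lebesgue_tuple_measure d :
  exists m : {sigma_finite_measure set (d.-tuple R) -> \bar R},
    (m : set _ -> \bar R) = leb d.
Proof.
elim: d => [|d [m mE]]; first by exists (\d_([tuple] : 0.-tuple R)).
by exists (cons_measure m); apply/funext => A /=; rewrite -mE cons_measureE.
Qed.

Section Instances.
Variable d : nat.

Let leb0 : leb d set0 = 0%E.
Proof. by have [m <-] := lebesgue_tuple_measure d; exact: measure0. Qed.

Let leb_ge0 A : (0 <= leb d A)%E.
Proof. by have [m <-] := lebesgue_tuple_measure d; exact: measure_ge0. Qed.

Let leb_sigma_additive : semi_sigma_additive (leb d).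
Proof.
have [m <-] := lebesgue_tuple_measure d.
exact: measure_semi_sigma_additive.
Qed.

HB.instance Definition _ := isMeasure.Build _ _ _ (leb d)
  leb0 leb_ge0 leb_sigma_additive.

Let leb_sigma_finite : sigma_finite setT (leb d).
Proof. by have [m <-] := lebesgue_tuple_measure d; exact: sigma_finiteT. Qed.

HB.instance Definition _ := Measure_isSigmaFinite.Build _ _ _ (leb d)
  leb_sigma_finite.

End Instances.

Lemma lebesgue_tupleS d (A : set (d.+1.-tuple R)) :
  leb d.+1 A = (\int[mu]_x leb d [set v | A (cons_tuple x v)])%E.
Proof. by []. Qed.

Lemma lebesgue_tuple_prod d (A : set (d.+1.-tuple R)) :
  leb d.+1 A = (mu \x leb d)%E (@conspair d @^-1` A).
Proof. by rewrite lebesgue_tupleS -cons_measureE. Qed.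

(** Tonelli for an indicator: the two orders of slicing agree on rectangles, hence everywhere by
    uniqueness of the product measure. *)
Lemma lebesgue_tupleS_swap d (A : set (d.+1.-tuple R)) : measurable A ->
  leb d.+1 A = (\int[leb d]_v mu [set x | A (cons_tuple x v)])%E.
Proof.
move=> mA; rewrite lebesgue_tuple_prod.
rewrite (product_measure_unique (m' := (mu \x^ leb d)%E)); first last.
- by rewrite -[X in measurable X]setTI; exact: measurable_conspair.
- by move=> B C mB mC; rewrite /= product_measure2E.
apply: eq_integral => v _ /=; congr (mu _).
by apply/seteqP; split => x; rewrite /ysection/= inE.
Qed.

(** The translated measure gives half-open intervals their length, and this characterizes Lebesgue
    measure. *)
Lemma lebesgue_measureD (c : R) (A : set R) : measurable A ->
  mu [set x | A (x + c)] = mu A.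
Proof.
move=> mA.
have mD : measurable_fun setT (fun x : R => x + c : measurableTypeR R).
  by apply: measurable_funD.
have : pushforward mu (fun x : R => x + c : measurableTypeR R) A = mu A.
  apply/esym/lebesgue_measure_unique => //= _ [[a b]] _ <-.
  rewrite /pushforward/= (_ : _ @^-1` _ = `]a - c, b - c]%classic).
    rewrite !lebesgue_measure_itv/= !lte_fin ltrD2r.
    by case: ifP => // _; rewrite -!EFinB; congr (_%:E); ring.
  by apply/seteqP; split=> x; rewrite /= !in_itv/= ltrBlDr lerBrDr.
by [].
Qed.

Lemma lebesgue_measureZ (c : R) (A : set R) : 0 < c -> measurable A ->
  mu [set x | A (c * x)] = (c^-1%:E * mu A)%E.
Proof.
move=> c0 mA.
have mD : measurable_fun setT (fun x : R => c * x : measurableTypeR R).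
  by apply: measurable_funM.
(* The pushforward gives []a, b]] the mass [(b - a) / c]; the factor [c] restores its length. *)
pose m' := mscale (NngNum (ltW c0)) (pushforward mu (fun x : R => c * x : measurableTypeR R)).
have E : mu A = (c%:E * mu [set x | A (c * x)%R])%E.
  rewrite -[RHS]/(m' mD A).
  apply/lebesgue_measure_unique => //= _ [[a b]] _ <-.
  rewrite /m'/mscale/=/pushforward/= (_ : _ @^-1` _ = `]a / c, b / c]%classic).
    rewrite !lebesgue_measure_itv/= !lte_fin ltr_pM2r ?invr_gt0//.
    case: ifP => // _; last by rewrite mule0.
    rewrite -!EFinB -EFinM; congr (_%:E).
    by rewrite mulrBr !(mulrC c) !divfK ?gt_eqF.
  by apply/seteqP; split=> x; rewrite /= !in_itv/= ltr_pdivrMr// ler_pdivlMr// (mulrC x).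
by rewrite E muleA -EFinM mulVf ?gt_eqF// mul1e.
Qed.

End LebesgueTuple.

(** * Linear changes of variables *)

Section LinearMaps.
Variable R : realType.
Local Notation mu := (@lebesgue_measure R).
Local Notation leb d := (@lebesgue_tuple R d).

Lemma lebesgue_measureZ_neq0 (c : R) (A : set R) : c != 0 -> measurable A ->
  mu [set x | A (c * x)] = (`|c|^-1%:E * mu A)%E.
Proof.
move=> c0 mA; have [cp|cn|] := ltgtP c 0; last by move=> /eqP; rewrite (negPf c0).
  rewrite ltr0_norm// -lebesgue_measureZ ?oppr_gt0//.
  rewrite -[RHS]lebesgue_measureN; last first.
    rewrite -[X in measurable X]setTI.
    by have := @measurable_funM _ _ R setT (cst (- c)) id; apply.
  by congr (mu _); apply/seteqP; split=> x /=; rewrite mulrNN.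
by rewrite gtr0_norm// lebesgue_measureZ.
Qed.

Lemma measurable_fun_fiber1 d (A : set (d.+1.-tuple R)) : measurable A ->
  measurable_fun setT (fun x => leb d [set v | A (cons_tuple x v)]).
Proof.
move=> mA.
have mA' : measurable (@conspair R d @^-1` A).
  by rewrite -[X in measurable X]setTI; exact: measurable_conspair.
rewrite (_ : (fun x => _) = leb d \o xsection (@conspair R d @^-1` A)).
  exact: measurable_fun_xsection.
apply/funext => x /=; congr (lebesgue_tuple _).
by apply/seteqP; split => v; rewrite /xsection/= inE.
Qed.

Lemma measurable_fun_fiber2 d (A : set (d.+1.-tuple R)) : measurable A ->
  measurable_fun setT (fun v => mu [set x | A (cons_tuple x v)]).
Proof.
move=> mA.
have mA' : measurable (@conspair R d @^-1` A).
  by rewrite -[X in measurable X]setTI; exact: measurable_conspair.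
rewrite (_ : (fun x => _) = mu \o ysection (@conspair R d @^-1` A)).
  exact: measurable_fun_ysection.
apply/funext => x /=; congr (mu _).
by apply/seteqP; split => v; rewrite /ysection/= inE.
Qed.

Lemma measurable_fiber1 d (A : set (d.+1.-tuple R)) x : measurable A ->
  measurable [set v | A (cons_tuple x v)].
Proof.
move=> mA; rewrite -[X in measurable X]setTI.
by have := @measurable_cons _ _ _ R (cst x) d id; apply.
Qed.

Lemma measurable_fiber2 d (A : set (d.+1.-tuple R)) v : measurable A ->
  measurable [set x | A (cons_tuple x v)].
Proof.
move=> mA; rewrite -[X in measurable X]setTI.
by have := @measurable_cons _ _ R R id d (cst v); apply.
Qed.

(** Meant for maps that fix the head and act on each slice; [lebesgue_tuple_fiber2] serves maps that
    fix the tail and slices in the other order. *)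
Lemma lebesgue_tuple_fiber1 d (k : R) (A A' : set (d.+1.-tuple R)) :
  0 <= k -> measurable A ->
  (forall x, leb d [set v | A' (cons_tuple x v)] =
             (k%:E * leb d [set v | A (cons_tuple x v)])%E) ->
  leb d.+1 A' = (k%:E * leb d.+1 A)%E.
Proof.
move=> k0 mA AA'; rewrite !lebesgue_tupleS -ge0_integralZl//.
  by apply: eq_integral => x _; exact: AA'.
exact: measurable_fun_fiber1.
Qed.

Lemma lebesgue_tuple_fiber2 d (k : R) (A A' : set (d.+1.-tuple R)) :
  0 <= k -> measurable A -> measurable A' ->
  (forall v, mu [set x | A' (cons_tuple x v)] =
             (k%:E * mu [set x | A (cons_tuple x v)])%E) ->
  leb d.+1 A' = (k%:E * leb d.+1 A)%E.
Proof.
move=> k0 mA mA' AA'; rewrite !lebesgue_tupleS_swap// -ge0_integralZl//.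
  by apply: eq_integral => x _; exact: AA'.
exact: measurable_fun_fiber2.
Qed.

Definition tadd d (v c : d.-tuple R) : d.-tuple R :=
  [tuple tnth v i + tnth c i | i < d].

Definition row_of d (v : d.-tuple R) : 'rV[R]_d := \row_i tnth v i.

Definition tmulmx d (M : 'M[R]_d) (v : d.-tuple R) : d.-tuple R :=
  [tuple (row_of v *m M) 0 i | i < d].

Lemma row_of_tmulmx d (M : 'M[R]_d) v : row_of (tmulmx M v) = row_of v *m M.
Proof. by apply/rowP => i; rewrite !mxE tnth_mktuple !mxE. Qed.

Lemma row_of_inj d : injective (@row_of d).
Proof.
move=> v w vw; apply: eq_from_tnth => i.
by move/rowP : vw => /(_ i); rewrite !mxE.
Qed.

Lemma tmulmx_mul d (M N : 'M[R]_d) v : tmulmx (M *m N) v = tmulmx N (tmulmx M v).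
Proof. by apply: row_of_inj; rewrite !row_of_tmulmx mulmxA. Qed.

Lemma tmulmx1 d v : tmulmx (1%:M : 'M[R]_d) v = v.
Proof. by apply: row_of_inj; rewrite !row_of_tmulmx mulmx1. Qed.

Lemma measurable_tmulmx d (M : 'M[R]_d) : measurable_fun setT (tmulmx M).
Proof.
apply/measurable_fun_tnthP => i.
rewrite (_ : _ \o _ = fun v => \sum_j tnth v j * M j i); last first.
  by apply/funext => v /=; rewrite tnth_mktuple mxE; apply: eq_bigr => j _; rewrite mxE.
apply: measurable_sum => j; apply: measurable_funM => //.
exact: measurable_tnth.
Qed.

Lemma measurable_tadd d c : measurable_fun setT (fun v : d.-tuple R => tadd v c).
Proof.
apply/measurable_fun_tnthP => i.
rewrite (_ : _ \o _ = fun v => tnth v i + tnth c i); last first.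
  by apply/funext => v /=; rewrite tnth_mktuple.
by apply: measurable_funD => //; exact: measurable_tnth.
Qed.

Lemma tadd_cons d x y (v w : d.-tuple R) :
  tadd (cons_tuple x v) (cons_tuple y w) = cons_tuple (x + y) (tadd v w).
Proof.
apply: eq_from_tnth => i; rewrite tnth_mktuple.
case: (unliftP ord0 i) => [j|] ->; last by rewrite !tnth0.
by rewrite !tnthS tnth_mktuple.
Qed.

Lemma measurable_preimage_tuple d e (f : d.-tuple R -> e.-tuple R) A :
  measurable_fun setT f -> measurable A -> measurable [set v | A (f v)].
Proof. by move=> mf mA; rewrite -[X in measurable X]setTI; exact: mf. Qed.

Lemma lebesgue_tupleD d (c : d.-tuple R) A : measurable A ->
  leb d [set v | A (tadd v c)] = leb d A.
Proof.
elim: d c A => [|d IH] c A mA.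
  by congr (lebesgue_tuple _); apply/seteqP; split => v /=;
    rewrite (tuple0 v) [tadd _ _]tuple0.
set c0 := thead c; pose c' : d.-tuple R := behead_tuple c.
have -> : c = cons_tuple c0 c' by rewrite [LHS]tuple_eta; exact: val_inj.
(* Here only the head is translated: the tail is moved by induction on each slice, then the head by
   invariance on the line. *)
pose A1 : set (d.+1.-tuple R) := [set v | A (tadd v (cons_tuple c0 [tuple 0 | i < d]))].
have E x v : A1 (cons_tuple x v) = A (cons_tuple (x + c0) v).
  rewrite /A1/= tadd_cons; congr (A (cons_tuple _ _)).
  by apply: eq_from_tnth => i; rewrite !tnth_mktuple addr0.
have mA1 : measurable A1 by apply: measurable_preimage_tuple => //; exact: measurable_tadd.
transitivity (leb d.+1 A1).
  rewrite -[RHS]mul1e; apply: lebesgue_tuple_fiber1 => // x; rewrite mul1e.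
  rewrite /=; under eq_set do rewrite tadd_cons.
  rewrite (IH c' [set v | A (cons_tuple (x + c0) v)]); last exact: measurable_fiber1.
  by under [in RHS]eq_set do rewrite E.
rewrite -[RHS]mul1e; apply: lebesgue_tuple_fiber2 => // v; rewrite mul1e.
rewrite /=; under eq_set do rewrite E.
by rewrite (lebesgue_measureD c0 (A := [set x | A (cons_tuple x v)]))//;
  exact: measurable_fiber2.
Qed.

(** Preimages are measured, so for an invertible matrix the factor is the reciprocal of the absolute
    value of the determinant. *)
Definition scales_leb d (f : d.-tuple R -> d.-tuple R) (c : R) : Prop :=
  forall A, measurable A -> leb d [set v | A (f v)] = (c%:E * leb d A)%E.

Lemma row_of_cons d x (v : d.-tuple R) :
  row_of (cons_tuple x v) = row_mx x%:M (row_of v) :> 'rV[R]_(1 + d).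
Proof.
apply/rowP => i; rewrite mxE; case: (splitP i) => j ij.
  rewrite (_ : i = lshift d j); last exact: val_inj.
  by rewrite row_mxEl ord1 mxE eqxx /= (_ : lshift d 0 = ord0)//; exact: val_inj.
rewrite (_ : i = rshift 1 j); last exact: val_inj.
rewrite row_mxEr mxE (_ : rshift 1 j = lift ord0 j) ?tnthS//.
exact: val_inj.
Qed.

Lemma tmulmx_block d (a : R) (p : 'rV[R]_d) (q : 'cV[R]_d) (D : 'M[R]_d) x (v : d.-tuple R) :
  tmulmx (block_mx a%:M p q D : 'M[R]_(1 + d)) (cons_tuple x v) =
  cons_tuple (x * a + (row_of v *m q) 0 0)
    [tuple x * p 0 i + tnth (tmulmx D v) i | i < d].
Proof.
apply: row_of_inj; rewrite row_of_tmulmx !row_of_cons mul_row_block; congr row_mx.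
  by rewrite -scalar_mxM [in RHS]raddfD/= -mx11_scalar.
apply/rowP => i; rewrite mul_scalar_mx !mxE !tnth_mktuple mxE//.
Qed.

Lemma scales_comp d (M N : 'M[R]_d) c c' :
  scales_leb (tmulmx M) c -> scales_leb (tmulmx N) c' ->
  scales_leb (tmulmx (M *m N)) (c * c').
Proof.
move=> Mc Nc A mA; rewrite /=; under eq_set do rewrite tmulmx_mul.
rewrite (Mc [set v | A (tmulmx N v)]).
  by rewrite Nc// muleA EFinM.
by apply: measurable_preimage_tuple => //; exact: measurable_tmulmx.
Qed.

(** For a fixed head [x] this shear translates the tail by [x *: p], so every slice keeps its
    volume. In [scales_upper] the tail is fixed and the head is translated. *)
Lemma scales_lower d (p : 'rV[R]_d) :
  scales_leb (tmulmx (block_mx 1%:M p 0 1%:M : 'M[R]_(1 + d))) 1.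
Proof.
move=> A mA; apply: lebesgue_tuple_fiber1 => // x; rewrite mul1e.
rewrite -(lebesgue_tupleD [tuple x * p 0 i | i < d] (A := [set v | A (cons_tuple x v)])).
  congr (leb _ _); apply/funext => v /=; rewrite tmulmx_block mulmx0 mxE mulr1 addr0.
  congr (A (cons_tuple _ _)); apply: eq_from_tnth => i.
  by rewrite tnth_mktuple tmulmx1 ?tnth_mktuple addrC.
exact: measurable_fiber1.
Qed.

Lemma scales_upper d (q : 'cV[R]_d) :
  scales_leb (tmulmx (block_mx 1%:M 0 q 1%:M : 'M[R]_(1 + d))) 1.
Proof.
move=> A mA; apply: lebesgue_tuple_fiber2 => //.
  by apply: measurable_preimage_tuple => //; exact: measurable_tmulmx.
move=> v; rewrite mul1e.
rewrite -(lebesgue_measureD ((row_of v *m q) 0 0) (A := [set x | A (cons_tuple x v)])).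
  congr (mu _); apply/funext => x /=; rewrite tmulmx_block mulr1.
  congr (A (cons_tuple _ _)); apply: eq_from_tnth => i.
  by rewrite tnth_mktuple tmulmx1 ?tnth_mktuple mxE mulr0 add0r.
exact: measurable_fiber2.
Qed.

Lemma scales_diag d (a : R) (D : 'M[R]_d) c : a != 0 -> 0 <= c ->
  scales_leb (tmulmx D) c ->
  scales_leb (tmulmx (block_mx a%:M 0 0 D : 'M[R]_(1 + d))) (c * `|a|^-1).
Proof.
move=> a0 c0 Dc A mA.
(* The preimage under the scaling of the head alone, so that the two factors come from the two
   orders of slicing. *)
pose A1 := [set v | A (tmulmx (block_mx a%:M 0 0 1%:M : 'M[R]_(1 + d)) v)].
have mA1 : measurable A1.
  by apply: measurable_preimage_tuple => //; exact: measurable_tmulmx.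
have E x v : A1 (cons_tuple x v) = A (cons_tuple (a * x) v).
  rewrite /A1/= tmulmx_block mulmx0 mxE addr0 mulrC.
  congr (A (cons_tuple _ _)); apply: eq_from_tnth => i.
  by rewrite tnth_mktuple tmulmx1 ?tnth_mktuple mxE mulr0 add0r.
rewrite EFinM -muleA.
transitivity (c%:E * leb d.+1 A1)%E.
  apply: lebesgue_tuple_fiber1 => // x.
  under [in RHS]eq_set do rewrite E.
  rewrite -(Dc [set v | A (cons_tuple (a * x) v)]); last exact: measurable_fiber1.
  congr (leb _ _); apply/funext => v /=; rewrite tmulmx_block mulmx0 mxE addr0 mulrC.
  congr (A (cons_tuple _ _)); apply: eq_from_tnth => i.
  by rewrite tnth_mktuple mxE mulr0 add0r.
congr (_ * _)%E; apply: lebesgue_tuple_fiber2 => //.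
move=> v; rewrite /=; under eq_set do rewrite E.
by rewrite (lebesgue_measureZ_neq0 (A := [set x | A (cons_tuple x v)]))//; exact: measurable_fiber2.
Qed.

(* Gaussian elimination: once the corner entry is nonzero, a matrix is a product
   of two shears and a block diagonal matrix. *)
Lemma scales_unitmx d (M : 'M[R]_d) : M \in unitmx ->
  exists2 c, 0 <= c & scales_leb (tmulmx M) c.
Proof.
elim: d M => [|d IH] M uM.
  exists 1 => // A mA; rewrite mul1e; congr (leb _ _).
  by apply/funext => v /=; rewrite (tuple0 v) [tmulmx _ _]tuple0.
have pivot (N : 'M[R]_(1 + d)) : N \in unitmx -> N 0 0 != 0 ->
    exists2 c, 0 <= c & scales_leb (tmulmx N) c.
  move=> uN N0.
  set a := N 0 0 in N0; pose p := ursubmx N; pose q := dlsubmx N.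
  pose D := drsubmx N - q *m (a^-1 *: p).
  have aE : ulsubmx N = a%:M.
    by rewrite [LHS]mx11_scalar; congr _%:M; rewrite !mxE; congr (N _ _); exact: val_inj.
  have NE : N = block_mx 1%:M 0 (a^-1 *: q) 1%:M *m
      (block_mx a%:M 0 0 D *m block_mx 1%:M (a^-1 *: p) 0 1%:M).
    rewrite !mulmx_block !(mul0mx, mulmx0, mulmx1, mul1mx, addr0, add0r).
    rewrite -[LHS]submxK aE; congr block_mx.
    - by rewrite mul_scalar_mx scalerA divff// scale1r.
    - by rewrite mul_mx_scalar scalerA divff// scale1r.
    - rewrite /D mul_scalar_mx scalerA divff// scale1r -scalemxAl -scalemxAr.
      by rewrite addrC subrK.
  have uD : D \in unitmx.
    move: uN; rewrite NE !unitmx_mul => /and3P[_ + _].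
    by rewrite !unitmxE det_ublock det_scalar1 unitrM => /andP[].
  have [c c0 Dc] := IH _ uD.
  exists (1 * (c * `|a|^-1 * 1)).
    by rewrite mul1r mulr1 mulr_ge0// invr_ge0.
  rewrite NE; apply: scales_comp; first exact: scales_upper.
  apply: scales_comp; last exact: scales_lower.
  exact: scales_diag.
have [M0|] := eqVneq (M 0 0) 0; last exact: (pivot M).
pose p := ursubmx (M : 'M[R]_(1 + d)).
have [j pj] : exists j, p 0 j != 0.
  apply/existsP; apply: contraT; rewrite negb_exists => /forallP p0.
  have r0 : row 0 M = 0.
    apply/rowP => i; rewrite !mxE; case: (unliftP ord0 i) => [j|] ->//.
    move: (p0 j); rewrite negbK /p !mxE => /eqP pj0; rewrite -[RHS]pj0.
    by congr (M _ _); exact: val_inj.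
  have := row_mul 0 M (invmx M); rewrite mulmxV// r0 mul0mx => /rowP/(_ 0).
  by rewrite !mxE eqxx => /eqP; rewrite oner_eq0.
(* Multiplying by [S 1] on the right adds to the first column the one in which [pj] found a nonzero
   entry of the first row; this entry becomes the pivot, and [S (-1)] undoes the operation. *)
pose S (s : R) : 'M[R]_(1 + d) := block_mx 1%:M 0 (s *: delta_mx j 0) 1%:M.
have SS : S 1 *m S (-1) = 1%:M.
  rewrite mulmx_block !(mul0mx, mulmx0, mulmx1, mul1mx, addr0, add0r).
  by rewrite -scalerDl subrr scale0r -scalar_mx_block.
have uS : S 1 \in unitmx by have [] := mulmx1_unit SS.
have [] := pivot ((M : 'M[R]_(1 + d)) *m S 1).
- by rewrite unitmx_mul uM.
- rewrite -[M in M *m _](@submxK _ 1 d 1 d) mulmx_block.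
  rewrite (_ : (0 : 'I_(1 + d)) = lshift d 0); last exact: val_inj.
  rewrite block_mxEul !(mulmx1) scale1r mxE.
  have -> : ulsubmx (M : 'M[R]_(1 + d)) 0 0 = 0.
    by rewrite !mxE -[RHS]M0; congr (M _ _); exact: val_inj.
  by rewrite add0r -colE mxE.
move=> c c0 Mc; exists (c * 1); first by rewrite mulr1.
rewrite (_ : M = (M : 'M[R]_(1 + d)) *m S 1 *m S (-1)).
  by apply: scales_comp => //; exact: scales_upper.
by rewrite -mulmxA SS mulmx1.
Qed.

End LinearMaps.

(** * Isometries *)

Section Isometries.
Variable R : realType.
Local Notation mu := (@lebesgue_measure R).
Local Notation leb d := (@lebesgue_tuple R d).

Definition sqnorm d (v : d.-tuple R) : R := \sum_(i < d) tnth v i ^+ 2.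

Lemma sqnorm_ge0 d (v : d.-tuple R) : 0 <= sqnorm v.
Proof. by apply: sumr_ge0 => i _; exact: sqr_ge0. Qed.

Lemma enorm_ge0 d (v : d.-tuple R) : 0 <= enorm v.
Proof. exact: sqrtr_ge0. Qed.

Lemma sqnorm_cons d x (v : d.-tuple R) : sqnorm (cons_tuple x v) = x ^+ 2 + sqnorm v.
Proof.
rewrite /sqnorm big_ord_recl tnth0; congr (_ + _).
by apply: eq_bigr => i _; rewrite tnthS.
Qed.

Lemma measurable_sqnorm d : measurable_fun setT (@sqnorm d).
Proof.
apply: measurable_sum => i; apply: measurable_funX; exact: measurable_tnth.
Qed.

Lemma measurable_enorm d : measurable_fun setT (@enorm R d).
Proof.
have := @continuous_measurable_fun R (@Num.sqrt R) (@sqrt_continuous R).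
by move=> ms; apply: (measurableT_comp ms); exact: measurable_sqnorm.
Qed.

Definition unit_ball d : set (d.-tuple R) := [set v | sqnorm v <= 1].

Lemma measurable_le d (T : measurableType d) (f g : T -> R) :
  measurable_fun setT f -> measurable_fun setT g ->
  measurable [set x | f x <= g x].
Proof.
move=> mf mg; have := measurable_fun_ler mf mg.
by move=> /(_ measurableT [set true]); rewrite setTI; apply.
Qed.

Lemma measurable_lt d (T : measurableType d) (f g : T -> R) :
  measurable_fun setT f -> measurable_fun setT g ->
  measurable [set x | f x < g x].
Proof.
move=> mf mg; have := measurable_fun_ltr mf mg.
by move=> /(_ measurableT [set true]); rewrite setTI; apply.
Qed.

Lemma measurable_unit_ball d : measurable (@unit_ball d).
Proof. by apply: measurable_le => //; exact: measurable_sqnorm. Qed.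

Definition cube d (r : R) : set (d.-tuple R) := [set v | forall i, `|tnth v i| <= r].

Lemma measurable_cube d r : measurable (@cube d r).
Proof.
elim: d => [|d IH].
  by rewrite (_ : cube r = setT)//; apply/seteqP; split=> // v _ [].
rewrite (_ : cube r = [set v : d.+1.-tuple R | `|tnth v ord0| <= r] `&`
                      [set v : d.+1.-tuple R | @cube d r (behead_tuple v)]).
  apply: measurableI.
    apply: measurable_le => //; apply: measurableT_comp => //.
    exact: measurable_tnth.
  by rewrite -[X in measurable X]setTI; exact: measurable_behead.
apply/seteqP; split=> v; rewrite /cube/=.
  move=> h; split=> // i; have := h (lift ord0 i).
  by rewrite [v in tnth v _]tuple_eta tnthS.
move=> [h1 h2] i; case: (unliftP ord0 i) => [j|] ->//.
by rewrite [v in tnth v _]tuple_eta tnthS.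
Qed.

Lemma lebesgue_cube d (r : R) : 0 <= r -> leb d (cube r) = ((2 * r) ^+ d)%:E.
Proof.
move=> r0; elim: d => [|d IH].
  rewrite /= diracE mem_set// => -[]//.
rewrite exprS EFinM -IH.
have -> : (2 * r)%:E = mu `[- r, r].
  rewrite lebesgue_measure_itv/= lte_fin; case: ltP => rr.
    by rewrite -EFinB; congr _%:E; ring.
  by congr _%:E; apply/eqP; rewrite mulf_eq0 pnatr_eq0/= eq_le r0 andbT; lra.
rewrite lebesgue_tuple_prod -product_measure1E//; last exact: measurable_cube.
congr (product_measure1 _ _ _); apply/seteqP; split=> -[x v]; rewrite /cube/conspair/=.
  move=> h; split; first by rewrite in_itv/= -ler_norml; have := h ord0; rewrite tnth0.
  by move=> i; have := h (lift ord0 i); rewrite tnthS.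
rewrite in_itv/= -ler_norml => -[h1 h2] i.
by case: (unliftP ord0 i) => [j|] ->; rewrite ?tnthS ?tnth0.
Qed.

Lemma lebesgue_unit_ball_lty d : (leb d (@unit_ball d) < +oo)%E.
Proof.
apply: (@le_lt_trans _ _ ((2 * 1) ^+ d)%:E); last by rewrite ltry.
rewrite -lebesgue_cube//; apply: (@le_measure _ _ _ (leb d)); rewrite ?inE.
- exact: measurable_unit_ball.
- exact: measurable_cube.
move=> v /= v1 i; rewrite -[leRHS]sqrtr1 -sqrtr_sqr ler_sqrt//.
apply: le_trans v1; rewrite /sqnorm (bigD1 i)//= lerDl.
by apply: sumr_ge0 => j _; exact: sqr_ge0.
Qed.

Lemma lebesgue_unit_ball_gt0 d : (0 < leb d (@unit_ball d))%E.
Proof.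
(* A cube of half-side [1 / (d + 1)] fits in the ball, since [d] squares add up to at most
   [d / (d + 1)]; using [d + 1] also covers dimension 0. *)
have r0 : 0 < d.+1%:R^-1 :> R by rewrite invr_gt0.
apply: (@lt_le_trans _ _ ((2 * d.+1%:R^-1) ^+ d)%:E).
  by rewrite lte_fin exprn_gt0// mulr_gt0.
rewrite -(lebesgue_cube _ (ltW r0)); apply: (@le_measure _ _ _ (leb d)); rewrite ?inE.
- exact: measurable_cube.
- exact: measurable_unit_ball.
move=> v /= vr; rewrite /unit_ball/= /sqnorm.
apply: (@le_trans _ _ (\sum_(i < d) d.+1%:R^-1)).
  apply: ler_sum => i _; rewrite -real_normK ?num_real//.
  apply: (@le_trans _ _ (d.+1%:R^-1 ^+ 2)).
    by rewrite ler_sqr ?nnegrE// (ltW r0).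
  by rewrite expr2 ler_piMr ?(ltW r0)// invf_le1 ?ler1n.
rewrite sumr_const card_ord -[X in X *+ _]mul1r -mulrnAl.
by rewrite ler_pdivrMr// mul1r ler_nat.
Qed.

(* An isometry maps the unit ball onto itself, so its scaling factor is 1. *)
Lemma lebesgue_tmulmx_isometry d (M : 'M[R]_d) (A : set (d.-tuple R)) :
  (forall v, sqnorm (tmulmx M v) = sqnorm v) -> measurable A ->
  leb d [set v | A (tmulmx M v)] = leb d A.
Proof.
move=> Miso mA.
have uM : M \in unitmx.
  rewrite -row_free_unit; apply: inj_row_free => v vM.
  have := Miso [tuple v 0 i | i < d].
  have -> : sqnorm (tmulmx M [tuple v 0 i | i < d]) = 0.
    apply: big1 => i _; rewrite tnth_mktuple.
    rewrite (_ : row_of _ = v) ?vM ?mxE ?expr0n//.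
    by apply/rowP => j; rewrite mxE tnth_mktuple.
  move=> /esym/eqP; rewrite psumr_eq0 => [/allP h|i _]; last exact: sqr_ge0.
  apply/rowP => i; rewrite mxE; apply/eqP.
  by have := h i; rewrite mem_index_enum sqrf_eq0 tnth_mktuple; apply.
have [c c0 Mc] := scales_unitmx uM.
rewrite Mc//.
suff -> : c = 1 by rewrite mul1e.
have := Mc _ (@measurable_unit_ball d).
rewrite (_ : [set v | _] = @unit_ball d); last first.
  by apply/seteqP; split=> v; rewrite /unit_ball/= Miso.
have := lebesgue_unit_ball_lty d; have := lebesgue_unit_ball_gt0 d.
case: (leb d _) => // b; rewrite lte_fin => b0 _ [] /esym.
by rewrite -[X in _ = X]mul1r; apply: mulIf; rewrite gt_eqF.
Qed.

(** Accommodates maps given without a real matrix, such as complex unitary maps and two-sided matrix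
    products read in real coordinates. *)
Definition linear_tuple d (f : d.-tuple R -> d.-tuple R) : Prop :=
  forall (a : R) v w,
  f [tuple a * tnth v i + tnth w i | i < d] =
  [tuple a * tnth (f v) i + tnth (f w) i | i < d].

Lemma linear_tuple_tmulmx d (f : d.-tuple R -> d.-tuple R) : linear_tuple f ->
  exists M, f = tmulmx M.
Proof.
move=> fl.
pose g (v : 'rV[R]_d) := row_of (f [tuple v 0 i | i < d]).
have gl : linear g.
  move=> a v w; rewrite /g.
  rewrite (_ : [tuple (a *: v + w) 0 i | i < d] =
    [tuple a * tnth [tuple v 0 i | i < d] i + tnth [tuple w 0 i | i < d] i | i < d]).
    by rewrite fl; apply/rowP => i; rewrite !mxE tnth_mktuple.
  by apply: eq_from_tnth => i; rewrite !tnth_mktuple !mxE.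
pose gL : {linear 'rV[R]_d -> 'rV[R]_d} :=
  HB.pack g (GRing.isLinear.Build _ _ _ _ g gl).
exists (lin1_mx gL); apply/funext => v; apply: row_of_inj.
rewrite row_of_tmulmx mul_rV_lin1 /= /g; congr (row_of (f _)).
by apply: eq_from_tnth => i; rewrite tnth_mktuple mxE.
Qed.

Lemma lebesgue_linear_isometry d (f : d.-tuple R -> d.-tuple R) A :
  linear_tuple f -> (forall v, sqnorm (f v) = sqnorm v) -> measurable A ->
  leb d [set v | A (f v)] = leb d A.
Proof.
move=> /linear_tuple_tmulmx[M ->]; exact: lebesgue_tmulmx_isometry.
Qed.

Lemma linear_tupleZ d (f : d.-tuple R -> d.-tuple R) (a : R) v :
  linear_tuple f -> f [tuple a * tnth v i | i < d] = [tuple a * tnth (f v) i | i < d].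
Proof.
move=> /linear_tuple_tmulmx[M ->]; apply: row_of_inj; rewrite row_of_tmulmx.
apply/rowP => i; rewrite !mxE !tnth_mktuple !mxE mulr_sumr.
by apply: eq_bigr => j _; rewrite !mxE tnth_mktuple mulrA.
Qed.

Lemma measurable_cone d (A : set (d.-tuple R)) :
  measurable A -> measurable (cone A).
Proof.
move=> mA.
rewrite (_ : cone A = ([set v | 0 < enorm v] `&` [set v | enorm v <= 1]) `&`
    [set v | A [tuple (enorm v)^-1 * tnth v i | i < d]]); last first.
  apply/seteqP; split=> v /=; first by move=> [/andP[]].
  by move=> [[v0 v1] Av]; split=> //; apply/andP.
apply: measurableI.
  apply: measurableI.
    by apply: measurable_lt => //; exact: measurable_enorm.
  by apply: measurable_le => //; exact: measurable_enorm.
apply: (measurable_preimage_tuple (f := fun v => [tuple (enorm v)^-1 * tnth v i | i < d])) => //.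
apply/measurable_fun_tnthP => i.
rewrite (_ : _ \o _ = fun v => (enorm v)^-1 * tnth v i); last first.
  by apply/funext => v /=; rewrite tnth_mktuple.
apply: measurable_funM; last exact: measurable_tnth.
(* Measurability of the inverse comes from that of the real power; at norm 0 both expressions have
   the value 0. *)
rewrite (_ : (fun v => _) = fun v => enorm v `^ (-1)); last first.
  by apply/funext => v /=; rewrite powR_inv1// enorm_ge0.
apply: (measurableT_comp (f := fun x => x `^ (-1))); last exact: measurable_enorm.
exact: measurable_powR.
Qed.

(** A linear isometry commutes with radial projection, so cones and preimages can be exchanged. *)
Lemma lebesgue_cone_isometry d (f : d.-tuple R -> d.-tuple R) A :
  linear_tuple f -> (forall v, sqnorm (f v) = sqnorm v) -> measurable A ->
  leb d (cone [set v | A (f v)]) = leb d (cone A).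
Proof.
move=> fl fiso mA.
have -> : cone [set v | A (f v)] = [set v | cone A (f v)].
  apply/seteqP; split=> v; rewrite /cone/= /enorm -!/(sqnorm _) fiso linear_tupleZ//.
apply: lebesgue_linear_isometry => //.
exact: measurable_cone.
Qed.

(* Integrating 1_Z(v + s c) over (s, v) gives leb Z times the length of the line
   in one order, by translation invariance, and 0 in the other. *)
Lemma lebesgue_tuple_lines0 d (Z : set (d.-tuple R)) (c : d.-tuple R) :
  measurable Z ->
  (forall v, mu [set s | Z (tadd v [tuple s * tnth c i | i < d])] = 0%E) ->
  leb d Z = 0%E.
Proof.
move=> mZ Z0.
(* The parameter [s] is stored as the head of a longer tuple, so that the two iterated integrals are
   the two slicings in dimension [d.+1]. *)
pose A : set (d.+1.-tuple R) :=
  [set v | Z (tadd (behead_tuple v) [tuple thead v * tnth c i | i < d])].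
have mA : measurable A.
  rewrite -[X in measurable X]setTI.
  suff : measurable_fun setT (fun v : d.+1.-tuple R => tadd (behead_tuple v) [tuple thead v * tnth c i | i < d]).
    by apply.
  apply/measurable_fun_tnthP => i.
  rewrite (_ : _ \o _ = fun v => tnth v (lift ord0 i) + tnth v ord0 * tnth c i); last first.
    apply/funext => v /=; rewrite !tnth_mktuple; congr (_ + _).
    by rewrite [in RHS](tuple_eta v) tnthS.
  apply: measurable_funD; first exact: measurable_tnth.
  apply: measurable_funM => //; exact: measurable_tnth.
have AE x v : A (cons_tuple x v) = Z (tadd v [tuple x * tnth c i | i < d]).
  by rewrite /A/=; congr (Z (tadd _ _)); exact: val_inj.
have : leb d.+1 A = 0%E.
  rewrite lebesgue_tupleS_swap//; apply: integral0_eq => v _.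
  by rewrite -(Z0 v); congr (mu _); apply/funext => x; rewrite /= AE.
rewrite lebesgue_tupleS (eq_integral (cst (leb d Z))); last first.
  move=> x _ /=; rewrite -(lebesgue_tupleD [tuple x * tnth c i | i < d] mZ).
  by congr (leb _ _); apply/funext => v; rewrite /= AE.
rewrite integral_cst// => /eqP; rewrite mule_eq0 => /orP[/eqP //|].
rewrite -[X in X == _]/(mu [set: R]) (_ : [set: R] = `]-oo, +oo[%classic); last first.
  by rewrite set_itvE.
by rewrite lebesgue_measure_itv.
Qed.

End Isometries.

(** * Coordinates of a uniform vector *)

Section Beta.
Variable R : realType.
Local Notation mu := (@lebesgue_measure R).
Local Notation leb d := (@lebesgue_tuple R d).

Lemma lebesgue_tuple1 (B : set R) : measurable B ->
  leb 1 [set u | B (thead u)] = mu B.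
Proof.
move=> mB.
rewrite lebesgue_tupleS_swap; last first.
  by rewrite -[X in measurable X]setTI; exact: measurable_tnth.
rewrite (eq_integral (cst (mu B))); last by move=> v _; congr (mu _).
by rewrite integral_cst// /= diracT mule1.
Qed.

(** Isolates the two real coordinates of the first complex one, so that slices become planar
    regions. Tonelli moves the integral over the tail to the outside. *)
Lemma lebesgue_tupleSS d (A : set (d.+2.-tuple R)) : measurable A ->
  leb d.+2 A = (\int[leb d]_w leb 2
    [set z | A (cons_tuple (thead z) (cons_tuple (thead (behead_tuple z)) w))])%E.
Proof.
move=> mA.
pose f (p : R * d.-tuple R) := mu [set y | A (cons_tuple p.1 (cons_tuple y p.2))].
have mf : measurable_fun setT f.
  pose B : set ((R * d.-tuple R) * R) :=
    [set q | A (cons_tuple q.1.1 (cons_tuple q.2 q.1.2))].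
  have mB : measurable B.
    rewrite -[X in measurable X]setTI.
    suff : measurable_fun setT (fun q : (R * d.-tuple R) * R =>
      cons_tuple q.1.1 (cons_tuple q.2 q.1.2)) by apply.
    apply: measurable_cons; first exact: (measurableT_comp measurable_fst).
    apply: measurable_cons; first exact: measurable_snd.
    exact: (measurableT_comp measurable_snd).
  rewrite (_ : f = mu \o xsection B); first exact: measurable_fun_xsection.
  apply/funext => p /=; congr (mu _).
  by apply/seteqP; split => v; rewrite /xsection/= inE.
transitivity (\int[mu]_x \int[leb d]_w f (x, w))%E.
  rewrite lebesgue_tupleS; apply: eq_integral => x _.
  by rewrite lebesgue_tupleS_swap//; exact: measurable_fiber1.
have := @fubini_tonelli _ _ _ _ R mu (leb d) f mf.
rewrite /fubini_F /fubini_G => ->; last by move=> p; exact: measure_ge0.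
apply: eq_integral => w _; rewrite lebesgue_tupleS.
apply: eq_integral => x _; rewrite /f -lebesgue_tuple1; last first.
  by have := measurable_fiber2 w (measurable_fiber1 x mA).
congr (lebesgue_tuple _); apply/funext => u /=.
by rewrite (_ : behead_tuple (cons_tuple x u) = u)//; exact: val_inj.
Qed.

Lemma scales_scalar d (s : R) : s != 0 ->
  scales_leb (tmulmx (s%:M : 'M[R]_d)) (`|s|^-1 ^+ d).
Proof.
move=> s0; elim: d => [|d IH].
  rewrite expr0 => A mA; rewrite mul1e; congr (leb _ _).
  by apply/funext => v /=; rewrite (tuple0 v) [tmulmx _ _]tuple0.
rewrite exprSr.
have -> : s%:M = block_mx s%:M 0 0 s%:M :> 'M[R]_(1 + d) by rewrite -scalar_mx_block.
by apply: scales_diag => //; rewrite exprn_ge0// invr_ge0.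
Qed.

Lemma sqnorm_tmulmx_scalar d (s : R) (v : d.-tuple R) : sqnorm (tmulmx s%:M v) = s ^+ 2 * sqnorm v.
Proof.
rewrite /sqnorm mulr_sumr; apply: eq_bigr => i _.
by rewrite tnth_mktuple mul_mx_scalar !mxE exprMn.
Qed.

Definition disk d (s : R) : set (d.-tuple R) := [set v | sqnorm v <= s].

Lemma measurable_disk d s : measurable (@disk d s).
Proof. by apply: measurable_le => //; exact: measurable_sqnorm. Qed.

(** Here [s] is the squared radius, and in the plane area is linear in it. This makes areas of
    annuli differences of linear terms; the area of the unit disk can stay unevaluated. *)
Lemma lebesgue_disk (s : R) : 0 <= s ->
  leb 2 (disk s) = (s%:E * leb 2 (@unit_ball R 2))%E.
Proof.
rewrite le_eqVlt => /orP[/eqP <-|s0].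
  rewrite mul0e; apply/eqP; rewrite eq_le measure_ge0 andbT.
  have <- : leb 2 (cube 0) = 0%E by rewrite lebesgue_cube// mulr0 expr0n.
  apply: (@le_measure _ _ _ (leb 2)); rewrite ?inE.
  - exact: measurable_disk.
  - exact: measurable_cube.
  move=> v /= v0 i; rewrite normr_le0 -sqrf_eq0 eq_le sqr_ge0 andbT.
  apply: le_trans v0; rewrite /sqnorm (bigD1 i)//= lerDl.
  by apply: sumr_ge0 => j _; exact: sqr_ge0.
have q0 : Num.sqrt s != 0 by rewrite gt_eqF ?sqrtr_gt0.
have sE : `|(Num.sqrt s)^-1|^-1 ^+ 2 = s.
  by rewrite normfV invrK ger0_norm ?sqrtr_ge0// sqr_sqrtr// ltW.
have := scales_scalar (d := 2) (invr_neq0 q0) (@measurable_unit_ball R 2).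
rewrite sE => <-.
congr (leb _ _); apply/seteqP; split=> v; rewrite /disk /unit_ball/= sqnorm_tmulmx_scalar exprVn sqr_sqrtr ?(ltW s0)//.
  by rewrite ler_pdivrMl// mulr1.
by rewrite ler_pdivrMl// mulr1.
Qed.

Definition head2 d (v : d.+2.-tuple R) : R :=
  thead v ^+ 2 + thead (behead_tuple v) ^+ 2.

Lemma head2_cons d x y (w : d.-tuple R) :
  head2 (cons_tuple x (cons_tuple y w)) = x ^+ 2 + y ^+ 2.
Proof. by []. Qed.

Lemma measurable_head2 d : measurable_fun setT (@head2 d).
Proof.
apply: measurable_funD; apply: measurable_funX; first exact: measurable_tnth.
apply: (measurableT_comp (f := fun v : d.+1.-tuple R => tnth v ord0)).
  exact: measurable_tnth.
exact: measurable_behead.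
Qed.

Lemma sqnorm2 (z : 2.-tuple R) : thead z ^+ 2 + thead (behead_tuple z) ^+ 2 = sqnorm z.
Proof.
rewrite /sqnorm !big_ord_recl big_ord0 addr0; congr (_ + _ ^+ 2).
by rewrite /thead !(tnth_nth 0) /= nth_behead.
Qed.

(* Let z be the first two coordinates, w the others and c = t / (1 - t).  For
   fixed w the slice of the set is the annulus c|w|^2 < |z|^2 <= 1 - |w|^2, which
   has the area of the disk |z|^2 <= 1 - (1 + c)|w|^2, a slice of an ellipsoid. *)
Lemma lebesgue_head2_gt p (t : R) : 0 <= t < 1 ->
  leb (2 * p).+2 [set v | sqnorm v <= 1 /\ t * sqnorm v < head2 v] =
  (((1 - t) ^+ p)%:E * leb (2 * p).+2 (@unit_ball R _))%E.
Proof.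
move=> /andP[t0 t1]; have t1' : 0 < 1 - t by rewrite subr_gt0.
set d := (2 * p)%N; set W := [set v | _].
have mW : measurable W.
  apply: measurableI; first exact: measurable_unit_ball.
  apply: measurable_lt; last exact: measurable_head2.
  by apply: measurable_funM => //; exact: measurable_sqnorm.
(* Stretching [w] by [s], where [s ^+ 2 = 1 + c], turns the preimage of the unit ball into the
   ellipsoid; on [2 * p] coordinates the volume factor is [(1 - t) ^+ p]. *)
pose s := Num.sqrt (1 - t)^-1.
have s0 : s != 0 by rewrite gt_eqF// sqrtr_gt0 invr_gt0.
have s2 : s ^+ 2 = (1 - t)^-1 by rewrite sqr_sqrtr// invr_ge0 ltW.
pose D : 'M[R]_(1 + (1 + d)) := block_mx 1%:M 0 0 (block_mx 1%:M 0 0 s%:M).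
have DE x y w : tmulmx D (cons_tuple x (cons_tuple y w)) =
    cons_tuple x (cons_tuple y (tmulmx s%:M w)).
  rewrite tmulmx_block mulmx0 mxE addr0 mulr1; congr cons_tuple.
  apply: eq_from_tnth => i; rewrite tnth_mktuple mxE mulr0 add0r.
  rewrite tmulmx_block mulmx0 mxE addr0 mulr1; congr (tnth (cons_tuple _ _) _).
  by apply: eq_from_tnth => j; rewrite tnth_mktuple mxE mulr0 add0r.
have sc : scales_leb (tmulmx D) ((1 - t) ^+ p).
  have -> : (1 - t) ^+ p = `|s|^-1 ^+ d * `|1|^-1 * `|1|^-1.
    rewrite normr1 invr1 !mulr1 exprM exprVn real_normK ?num_real// s2.
    by rewrite invrK.
  have e0 : 0 <= `|s|^-1 ^+ d by rewrite exprn_ge0// invr_ge0.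
  apply: scales_diag; rewrite ?oner_neq0 ?normr1 ?invr1 ?mulr1//.
  have := @scales_diag R d 1 s%:M _ (oner_neq0 _) e0 (scales_scalar s0).
  by rewrite normr1 invr1 mulr1.
rewrite -(sc _ (@measurable_unit_ball R _)).
have mW' : measurable [set v | @unit_ball R _ (tmulmx D v)].
  apply: (measurable_preimage_tuple (f := tmulmx D)); first exact: measurable_tmulmx.
  exact: measurable_unit_ball.
rewrite (lebesgue_tupleSS mW) (lebesgue_tupleSS mW'); apply: eq_integral => w _.
set q := sqnorm w.
have q0 : 0 <= q := sqnorm_ge0 w.
pose c := t / (1 - t).
have c0 : 0 <= c by rewrite divr_ge0// ltW.
have cE : (1 - t)^-1 = 1 + c by rewrite /c; field; rewrite gt_eqF.
have -> : [set z : 2.-tuple R | [set v | @unit_ball R _ (tmulmx D v)]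
    (cons_tuple (thead z) (cons_tuple (thead (behead_tuple z)) w))] =
    disk (1 - (1 + c) * q).
  apply/seteqP; split=> z; rewrite /unit_ball /disk /= DE !sqnorm_cons;
  rewrite sqnorm_tmulmx_scalar s2 cE addrA sqnorm2 -/q; lra.
have -> : [set z : 2.-tuple R | W
    (cons_tuple (thead z) (cons_tuple (thead (behead_tuple z)) w))] =
    disk (1 - q) `\` disk (c * q).
  have key z : (t * (sqnorm z + q) < sqnorm z) = (c * q < sqnorm z) :> bool.
    rewrite -[RHS](ltr_pM2l t1') mulrA.
    have -> : (1 - t) * c = t by rewrite /c; field; rewrite gt_eqF.
    by rewrite mulrDr mulrBl mul1r ltrBrDl addrC.
  apply/seteqP; split=> z; rewrite /W /disk /=.
    rewrite !sqnorm_cons head2_cons addrA sqnorm2 -/q key => -[h1 h2].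
    by split; [lra | apply/negP; rewrite -ltNge].
  rewrite !sqnorm_cons head2_cons addrA sqnorm2 -/q key => -[h1 /negP].
  by rewrite -ltNge => h2; split; [lra|].
(* For larger [q] the annulus and the disk are both empty, and the area formula would give a
   negative value. *)
have [h|h] := leP ((1 + c) * q) 1; last first.
  have -> : disk (1 - (1 + c) * q) = set0 :> set (2.-tuple R).
    by apply/seteqP; split=> z //; rewrite /disk/=; have := sqnorm_ge0 z; lra.
  have -> : disk (1 - q) `\` disk (c * q) = set0 :> set (2.-tuple R).
    apply/seteqP; split=> z //; rewrite /disk/= => -[h1 /negP].
    by rewrite -ltNge; lra.
  by rewrite measure0.
have qc : c * q <= 1 - q by lra.
rewrite measureD; first last.
- have q1 : 0 <= 1 - q by have := mulr_ge0 c0 q0; lra.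
  rewrite [X in (X < _)%E](lebesgue_disk q1) lte_mul_pinfty ?lee_fin//.
  exact: lebesgue_unit_ball_lty.
- exact: measurable_disk.
- exact: measurable_disk.
rewrite (_ : _ `&` _ = disk (c * q)); last first.
  by apply/seteqP; split=> z; rewrite /disk/=; [move=> []|move=> hz; split=> //; lra].
have fb : leb 2 (@unit_ball R 2) \is a fin_num.
  by rewrite ge0_fin_numE ?measure_ge0// lebesgue_unit_ball_lty.
have h0 : 0 <= 1 - (1 + c) * q by lra.
have q1 : 0 <= 1 - q by have := mulr_ge0 c0 q0; lra.
rewrite (lebesgue_disk h0) [X in (X - _)%E](lebesgue_disk q1).
rewrite [X in (_ - X)%E](lebesgue_disk (mulr_ge0 c0 q0)).
rewrite -(fineK fb) -!EFinM -EFinB; congr (_%:E); ring.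
Qed.

Lemma lebesgue_head2_le p (t : R) : 0 <= t < 1 ->
  (leb (2 * p).+2 [set v | sqnorm v <= 1 /\ head2 v <= t * sqnorm v]%R <=
  (p%:R * t)%:E * leb (2 * p).+2 (@unit_ball R _))%E.
Proof.
move=> t01; have /andP[t0 t1] := t01.
set d := (2 * p)%N.
have mW : measurable [set v : d.+2.-tuple R | sqnorm v <= 1 /\ t * sqnorm v < head2 v].
  apply: measurableI; first exact: measurable_unit_ball.
  apply: measurable_lt; last exact: measurable_head2.
  by apply: measurable_funM => //; exact: measurable_sqnorm.
have -> : [set v : d.+2.-tuple R | sqnorm v <= 1 /\ head2 v <= t * sqnorm v] =
    @unit_ball R _ `\` [set v | sqnorm v <= 1 /\ t * sqnorm v < head2 v].
  apply/seteqP; split=> v /=; rewrite /unit_ball/=.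
    by move=> [h1 h2]; split=> // -[_]; rewrite ltNge h2.
  by move=> [h1 h2]; split=> //; rewrite leNgt; apply/negP => h3; apply: h2.
have fb : leb d.+2 (@unit_ball R _) \is a fin_num.
  by rewrite ge0_fin_numE ?measure_ge0// lebesgue_unit_ball_lty.
rewrite measureD ?lebesgue_unit_ball_lty//; last exact: measurable_unit_ball.
rewrite setIidr; last by move=> v [].
rewrite [X in (_ - X)%E](lebesgue_head2_gt p t01).
suff h : (leb d.+2 (@unit_ball R _) - ((1 - t) ^+ p)%:E * leb d.+2 (@unit_ball R _)
  <= (p%:R * t)%:E * leb d.+2 (@unit_ball R _))%E by exact: h.
rewrite -(fineK fb) -!EFinM -EFinB lee_fin.
rewrite -[X in X - _]mul1r -mulrBl ler_wpM2r ?fine_ge0 ?measure_ge0//.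
(* What remains is Bernoulli's inequality. *)
clear -t0 t1; elim: p => [|p IH]; first by rewrite expr0 subrr mul0r.
rewrite exprS -natr1.
have : 0 <= (1 - t) ^+ p <= 1 by rewrite exprn_ge0 ?exprn_ile1 ?subr_ge0 ?(ltW t1)// lerBlDr lerDl.
by move: IH; set e := _ ^+ p => IH /andP[e0 e1]; nra.
Qed.

End Beta.

(** * Complex vectors and cofactors *)

Section SquaredModulus.
Variable R : realType.
Local Notation C := R[i].

Definition sqmod (z : C) : R := complex.Re z ^+ 2 + complex.Im z ^+ 2.

Lemma sqmod_ge0 z : 0 <= sqmod z.
Proof. by rewrite addr_ge0 ?sqr_ge0. Qed.

Lemma sqmodC z : (sqmod z)%:C%C = Num.conj z * z.
Proof. by rewrite add_Re2_Im2 normCK mulrC. Qed.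

Lemma sqmodM z w : sqmod (z * w) = sqmod z * sqmod w.
Proof. case: z w => [a b] [c d]; rewrite /sqmod /=; ring. Qed.

Lemma sqmod_normc z : sqmod z = Normc.normc z ^+ 2.
Proof. by case: z => a b; rewrite /Normc.normc sqr_sqrtr ?addr_ge0 ?sqr_ge0. Qed.

Definition sqnormc k (v : 'cV[C]_k) : R := \sum_i sqmod (v i 0).

Lemma sqnormc_ge0 k (v : 'cV[C]_k) : 0 <= sqnormc v.
Proof. by apply: sumr_ge0 => i _; exact: sqmod_ge0. Qed.

Lemma sqnormcC k (v : 'cV[C]_k) : (sqnormc v)%:C%C = (v^t* *m v) 0 0.
Proof.
rewrite /sqnormc raddf_sum mxE; apply: eq_bigr => i _.
by rewrite /= sqmodC !mxE.
Qed.

Lemma sqnormc_unitary k (U : 'M[C]_k) v : U \is unitarymx -> sqnormc (U *m v) = sqnormc v.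
Proof.
rewrite -trmxC_unitary => /unitarymxP; rewrite trmxCK => UU.
apply: complexI; rewrite !sqnormcC trmx_mul map_mxM.
by rewrite -mulmxA (mulmxA _ U) UU mul1mx.
Qed.

Lemma sqnormcZ k (a : C) (v : 'cV[C]_k) : sqnormc (a *: v) = sqmod a * sqnormc v.
Proof. by rewrite /sqnormc mulr_sumr; apply: eq_bigr => i _; rewrite mxE sqmodM. Qed.

Lemma sqnormc_eq0 k (v : 'cV[C]_k) : (sqnormc v == 0) = (v == 0).
Proof.
apply/eqP/eqP => [/eqP|->]; last first.
  by apply: big1 => i _; rewrite mxE /sqmod /= expr0n addr0.
rewrite psumr_eq0 => [/allP h|i _]; last exact: sqmod_ge0.
apply/colP => i; rewrite [RHS]mxE; have := h i; rewrite mem_index_enum => /(_ isT).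
rewrite /sqmod paddr_eq0 ?sqr_ge0// !sqrf_eq0.
by case: (v i 0) => a b /= /andP[/eqP -> /eqP ->].
Qed.

Lemma sqmod_det_unitary k (U : 'M[C]_k) : U \is unitarymx -> sqmod (\det U) = 1.
Proof.
move=> /unitarymxP UU; apply: complexI; rewrite sqmodC.
rewrite -det_map_mx -[\det (map_mx _ _)]det_tr map_trmx -det_mulmx.
by rewrite (mulmx1C UU) det1.
Qed.

(** Gram-Schmidt applied to the matrix whose rows all equal [u] gives a unitary matrix whose first
    row spans [u], even for [u = 0]; a transposition of rows brings it to position [l]. *)
Lemma unitary_row k (l : 'I_k) (u : 'rV[C]_k) :
  exists U : 'M[C]_k, exists c : C, U \is unitarymx /\ u = c *: row l U.
Proof.
case: k l u => [[]//|k] l u.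
pose A : 'M[C]_k.+1 := \matrix_i u.
have uA : schmidt A \is unitarymx by exact: schmidt_unitarymx.
have [c uc] : exists c, u = c *: row 0 (schmidt A).
  have := row_schmidt_sub A 0; rewrite rowK (big_pred1 0); last first.
    by move=> i; rewrite leqn0.
  by rewrite genmxE => /sub_rVP[c ->]; exists c.
exists (xrow 0 l (schmidt A)), c; split.
  rewrite xrowE; apply: mul_unitarymx uA; apply/unitarymxP.
  rewrite -[RHS](_ : tperm_mx 0 l *m tperm_mx 0 l = _).
    by rewrite tr_tperm_mx; congr (_ *m _); apply/matrixP => i j; rewrite !mxE rmorph_nat.
  by rewrite -perm_mxM tperm2 perm_mx1.
by rewrite uc; congr (_ *: _); apply/rowP => j; rewrite !mxE tpermR.
Qed.

Lemma sqnormc_row_unitary k (l : 'I_k) (U : 'M[C]_k) : U \is unitarymx ->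
  sqnormc (row l U)^T = 1.
Proof.
move=> /unitarymxP UU; apply: complexI; rewrite sqnormcC.
rewrite -[RHS](_ : (1%:M : 'M[C]_k) l l = _); last by rewrite mxE eqxx.
rewrite -UU !mxE; apply: eq_bigr => j _; rewrite !mxE mulrC.
done.
Qed.

End SquaredModulus.

Section Cofactors.
Variables (F : comNzRingType) (k : nat).
Implicit Types (G U : 'M[F]_k) (l : 'I_k) (w : 'rV[F]_k).

(** The generalized cross product of the rows of [G] other than row [l]. *)
Definition cofac l G : 'cV[F]_k := \col_j cofactor G l j.

Definition set_row l w G : 'M[F]_k := \matrix_(i, j) if i == l then w 0 j else G i j.

Lemma mul_cofac l w G : (w *m cofac l G) 0 0 = \det (set_row l w G).
Proof.
rewrite (expand_det_row _ l) mxE; apply: eq_bigr => j _.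
rewrite !mxE eqxx; congr (_ * _); rewrite /cofactor; congr (_ * \det _).
apply/matrixP => i i'; rewrite !mxE.
by rewrite eq_sym (negPf (neq_lift _ _)).
Qed.

(* Pairing with a row w turns this into the multiplicativity of the determinant,
   so that U need not be invertible. *)
Lemma cofac_mulmx l G U : U *m cofac l (G *m U) = \det U *: cofac l G.
Proof.
apply/colP => j.
have e (x : 'cV[F]_k) : x j 0 = (delta_mx 0 j *m x : 'M[F]_1) 0 0.
  by rewrite -rowE mxE.
rewrite [RHS]mxE e mulmxA mul_cofac [cofac _ _ j 0]e mul_cofac mulrC -det_mulmx; congr (\det _).
apply/matrixP => i i'; rewrite !mxE; have [->|il] := eqVneq i l.
  by apply: eq_bigr => a _; rewrite [in RHS]mxE eqxx.
by apply: eq_bigr => a _; rewrite [in RHS]mxE (negPf il).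
Qed.

(** Cramer's rule without division: once row [l] is replaced by [w], the matrix sends [b] to a
    multiple of a basis vector, and its adjugate, whose column [l] is the cofactor vector, can be
    applied. *)
Lemma cofac_kernel l G (b : 'cV[F]_k) (w : 'rV[F]_k) :
  (forall i, i != l -> (G *m b) i 0 = 0) ->
  (w *m cofac l G) 0 0 *: b = (w *m b) 0 0 *: cofac l G.
Proof.
move=> Gb; rewrite mul_cofac -mul_scalar_mx -mul_adj_mx -mulmxA.
have -> : set_row l w G *m b = (w *m b) 0 0 *: delta_mx l 0.
  apply/colP => i; rewrite [RHS]mxE [X in _ * X]mxE.
  have [->|il] := eqVneq i l.
    by rewrite mulr1 !mxE; apply: eq_bigr => j _; rewrite mxE eqxx.
  rewrite mulr0 -(Gb i il) !mxE; apply: eq_bigr => j _.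
  by rewrite mxE (negPf il).
rewrite -scalemxAr -colE; congr (_ *: _); apply/colP => j.
rewrite !mxE /cofactor; congr (_ * \det _); apply/matrixP => i i'; rewrite !mxE.
by rewrite eq_sym (negPf (neq_lift _ _)).
Qed.

End Cofactors.

(** * Measurability of complex-valued functions and matrices *)

Section ComplexMeasurable.
Variables (R : realType) (d : measure_display) (T : measurableType d).
Local Notation C := R[i].

Definition cmeas (f : T -> C) : Prop :=
  measurable_fun setT (fun x => complex.Re (f x)) /\
  measurable_fun setT (fun x => complex.Im (f x)).

Lemma cmeas_cst c : cmeas (fun=> c).
Proof. by split; exact: measurable_cst. Qed.

Lemma cmeasD f g : cmeas f -> cmeas g -> cmeas (fun x => f x + g x).
Proof.
move=> [fr fi] [gr gi]; split.
  rewrite (_ : (fun x => _) = fun x => complex.Re (f x) + complex.Re (g x)).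
    exact: measurable_funD.
  by apply/funext => x; case: (f x) (g x) => [? ?] [].
rewrite (_ : (fun x => _) = fun x => complex.Im (f x) + complex.Im (g x)).
  exact: measurable_funD.
by apply/funext => x; case: (f x) (g x) => [? ?] [].
Qed.

Lemma cmeasM f g : cmeas f -> cmeas g -> cmeas (fun x => f x * g x).
Proof.
move=> [fr fi] [gr gi]; split.
  rewrite (_ : (fun x => _) = fun x => complex.Re (f x) * complex.Re (g x)
    - complex.Im (f x) * complex.Im (g x)).
    by apply: measurable_funB; exact: measurable_funM.
  by apply/funext => x; case: (f x) (g x) => [? ?] [].
rewrite (_ : (fun x => _) = fun x => complex.Re (f x) * complex.Im (g x)
  + complex.Im (f x) * complex.Re (g x)).
  by apply: measurable_funD; exact: measurable_funM.
by apply/funext => x; case: (f x) (g x) => [? ?] [].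
Qed.

Lemma cmeas_sum I (r : seq I) (P : pred I) (F : I -> T -> C) :
  (forall i, cmeas (F i)) -> cmeas (fun x => \sum_(i <- r | P i) F i x).
Proof.
move=> mF; elim: r => [|i r IH].
  rewrite (_ : (fun x => _) = fun=> 0); first exact: cmeas_cst.
  by apply/funext => x; rewrite big_nil.
rewrite (_ : (fun x => _) = fun x =>
  (if P i then F i x else 0) + \sum_(i <- r | P i) F i x).
  by apply: cmeasD => //; case: (P i) => //; exact: cmeas_cst.
by apply/funext => x; rewrite big_cons; case: (P i); rewrite ?add0r.
Qed.

Lemma cmeas_prod I (r : seq I) (P : pred I) (F : I -> T -> C) :
  (forall i, cmeas (F i)) -> cmeas (fun x => \prod_(i <- r | P i) F i x).
Proof.
move=> mF; elim: r => [|i r IH].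
  rewrite (_ : (fun x => _) = fun=> 1); first exact: cmeas_cst.
  by apply/funext => x; rewrite big_nil.
rewrite (_ : (fun x => _) = fun x =>
  (if P i then F i x else 1) * \prod_(i <- r | P i) F i x).
  by apply: cmeasM => //; case: (P i) => //; exact: cmeas_cst.
by apply/funext => x; rewrite big_cons; case: (P i); rewrite ?mul1r.
Qed.

Definition mx_cmeas m n (A : T -> 'M[C]_(m, n)) : Prop :=
  forall i j, cmeas (fun x => A x i j).

Lemma cmeas_mulmx m n p (A : T -> 'M[C]_(m, n)) (B : T -> 'M[C]_(n, p)) :
  mx_cmeas A -> mx_cmeas B -> mx_cmeas (fun x => A x *m B x).
Proof.
move=> mA mB i j.
rewrite (_ : (fun x => _) = fun x => \sum_l A x i l * B x l j).
  by apply: cmeas_sum => l; exact: cmeasM.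
by apply/funext => x; rewrite mxE.
Qed.

Lemma cmeas_det n (A : T -> 'M[C]_n) : mx_cmeas A -> cmeas (fun x => \det (A x)).
Proof.
move=> mA; apply: cmeas_sum => s; apply: cmeasM; first exact: cmeas_cst.
by apply: cmeas_prod => i; exact: mA.
Qed.

Lemma cmeas_cofac n l (A : T -> 'M[C]_n) : mx_cmeas A ->
  mx_cmeas (fun x => cofac l (A x)).
Proof.
move=> mA j i.
rewrite (_ : (fun x => _) = fun x => cofactor (A x) l j); last first.
  by apply/funext => x; rewrite mxE.
apply: cmeasM; first exact: cmeas_cst.
apply: cmeas_det => a b.
rewrite (_ : (fun x => _) = fun x => A x (lift l a) (lift j b)) //.
by apply/funext => x; rewrite !mxE.
Qed.

Lemma measurable_sqmod f : cmeas f -> measurable_fun setT (fun x => sqmod (f x)).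
Proof. by move=> [fr fi]; apply: measurable_funD; exact: measurable_funX. Qed.

Lemma measurable_sqnormc n (v : T -> 'cV[C]_n) : mx_cmeas v ->
  measurable_fun setT (fun x => sqnormc (v x)).
Proof. by move=> mv; apply: measurable_sum => i; exact: measurable_sqmod. Qed.

End ComplexMeasurable.

(** * The law of the cofactor vector *)

Section Rotation.
Variables (R : realType) (p : nat).
Local Notation C := R[i].
Local Notation leb d := (@lebesgue_tuple R d).
Local Notation tup := ((2 * p).+2.-tuple R).

Definition cvec (v : tup) : 'cV[C]_p.+1 :=
  \col_j Complex (nth 0 v (2 * j)) (nth 0 v (2 * j).+1).

Lemma sum_pairs (V : nmodType) (F : nat -> V) q :
  \sum_(i < (2 * q).+2) F i = \sum_(j < q.+1) (F (2 * j)%N + F (2 * j).+1).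
Proof.
elim: q => [|q IH]; first by rewrite muln0 !big_ord_recr !big_ord0 /= !add0r muln0.
by rewrite [RHS]big_ord_recr -IH /= mulnS [LHS]big_ord_recr [X in X + _ = _]big_ord_recr /= -addrA.
Qed.

Lemma sqnormc_cvec v : sqnormc (cvec v) = sqnorm v.
Proof.
rewrite /sqnorm (eq_bigr (fun i : 'I_(2 * p).+2 => nth 0 v i ^+ 2)); last first.
  by move=> i _; rewrite (tnth_nth 0).
rewrite (sum_pairs (fun i => nth 0 v i ^+ 2)).
by apply: eq_bigr => j _; rewrite mxE.
Qed.

Lemma nth_tuple_of (F : nat -> R) n i : (i < n)%N ->
  nth 0 [tuple F j | j < n] i = F i.
Proof.
move=> lin; have <- := tnth_nth 0 [tuple F j | j < n] (Ordinal lin).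
by rewrite tnth_mktuple.
Qed.

Lemma ltn_pair (j : 'I_p.+1) : (2 * j < (2 * p).+2)%N /\ ((2 * j).+1 < (2 * p).+2)%N.
Proof.
have : (2 * j <= 2 * p)%N by rewrite leq_mul2l -ltnS ltn_ord.
by rewrite !ltnS => h; split => //; exact: leqW.
Qed.

Lemma cvec_linear a (v w : tup) :
  cvec [tuple a * tnth v i + tnth w i | i < (2 * p).+2] = a%:C%C *: cvec v + cvec w.
Proof.
have E : [tuple a * tnth v i + tnth w i | i < (2 * p).+2] =
    [tuple a * nth 0 v i + nth 0 w i | i < (2 * p).+2].
  by apply: eq_from_tnth => i; rewrite !tnth_mktuple !(tnth_nth 0).
rewrite E; apply/colP => j; rewrite !mxE; have [h1 h2] := ltn_pair j.
rewrite !(nth_tuple_of (fun i => a * nth 0 v i + nth 0 w i))//.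
by apply/eqP; rewrite eq_complex /= !mul0r subr0 addr0 !eqxx.
Qed.

Lemma cvec_inj : injective cvec.
Proof.
move=> v w vw; have := cvec_linear (-1) w v.
rewrite -vw rmorphN1 scaleN1r addNr => /(congr1 (@sqnormc R p.+1)).
rewrite sqnormc_cvec => h; have {h} : sqnorm [tuple -1 * tnth w i + tnth v i | i < (2 * p).+2] = 0.
  by rewrite h; apply/eqP; rewrite sqnormc_eq0.
move=> /eqP; rewrite psumr_eq0 => [/allP h|i _]; last exact: sqr_ge0.
apply: eq_from_tnth => i; have := h i; rewrite mem_index_enum => /(_ isT).
by rewrite sqrf_eq0 tnth_mktuple mulN1r addrC subr_eq0 => /eqP.
Qed.

Definition realify (z : 'cV[C]_p.+1) : tup :=
  [tuple (if odd i then complex.Im (z (inord i./2) 0)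
          else complex.Re (z (inord i./2) 0)) | i < (2 * p).+2].

Lemma realifyK z : cvec (realify z) = z.
Proof.
apply/colP => j; rewrite mxE; have [h1 h2] := ltn_pair j.
pose F i := if odd i then complex.Im (z (inord i./2) 0)
          else complex.Re (z (inord i./2) 0).
rewrite /realify !(nth_tuple_of F)// /F /= mul2n odd_double/= uphalf_double doubleK inord_val.
by case: (z j 0).
Qed.

Lemma head2_cvec v : head2 v = sqmod (cvec v 0 0).
Proof.
rewrite mxE /sqmod /= muln0 /head2 /thead !(tnth_nth 0) /=.
by rewrite nth_behead.
Qed.

Lemma cmeas_cvec : mx_cmeas cvec.
Proof.
move=> j i; have [h1 h2] := ltn_pair j; split.
  rewrite (_ : (fun x => _) = fun v => tnth v (Ordinal h1)).
    exact: measurable_tnth.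
  by apply/funext => v; rewrite mxE (tnth_nth 0).
rewrite (_ : (fun x => _) = fun v => tnth v (Ordinal h2)).
  exact: measurable_tnth.
by apply/funext => v; rewrite mxE (tnth_nth 0).
Qed.

(** A unitary matrix whose first row is proportional to [u] turns the pairing with [u] into the
    first complex coordinate, up to a scalar of squared modulus [sqnormc u^T], which is positive and
    cancels. *)
Lemma lebesgue_rotation (u : 'rV[C]_p.+1) (t : R) : 0 < sqnormc u^T ->
  leb _ [set v : tup | sqnorm v <= 1 /\ sqmod ((u *m cvec v) 0 0) <= t * sqnormc u^T * sqnorm v] =
  leb _ [set v : tup | sqnorm v <= 1 /\ head2 v <= t * sqnorm v].
Proof.
move=> u0; have [U [c [uU uE]]] := unitary_row 0 u.
pose f (v : tup) := realify (U *m cvec v).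
have fsq v : sqnorm (f v) = sqnorm v by rewrite -!sqnormc_cvec realifyK sqnormc_unitary.
have fl : linear_tuple f.
  move=> a v w; apply: cvec_inj; rewrite cvec_linear !realifyK cvec_linear.
  by rewrite mulmxDr scalemxAr.
have uc : sqnormc u^T = sqmod c.
  by rewrite uE linearZ sqnormcZ sqnormc_row_unitary// mulr1.
have <- : [set v | [set v : tup | sqnorm v <= 1 /\ head2 v <= t * sqnorm v] (f v)] =
    [set v : tup | sqnorm v <= 1 /\ sqmod ((u *m cvec v) 0 0) <= t * sqnormc u^T * sqnorm v].
  apply/funext => v /=; rewrite fsq head2_cvec realifyK uc.
  have -> : (u *m cvec v) 0 0 = c * (U *m cvec v) 0 0.
    by rewrite uE -scalemxAl -row_mul mxE [row _ _ _ _]mxE.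
  rewrite sqmodM.
  by rewrite (mulrC t (sqmod c)) -mulrA ler_pM2l// -uc.
apply: lebesgue_linear_isometry => //.
apply: measurableI; first exact: measurable_unit_ball.
apply: measurable_le; first exact: measurable_head2.
by apply: measurable_funM => //; exact: measurable_sqnorm.
Qed.

End Rotation.

(** The quotient of squared moduli is at most [t], in product form; the strict inequality excludes
    the zero vector, which would satisfy the other condition for every [t]. *)
Definition small_coord (R : realType) k (l : 'I_k) (t : R) (M : 'cV[R[i]]_k) : Prop :=
  0 < sqnormc M /\ sqmod (M l 0) <= t * sqnormc M.

Section RandomCofactors.
Variables (R : realType) (disp : measure_display) (T : measurableType disp).
Variable P : probability T R.
Local Notation C := R[i].
Local Notation leb d := (@lebesgue_tuple R d).

(* By invariance, P S is at most the probability that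
   |<z, M>|^2 <= t |M|^2 |z|^2 with M the cofactor vector, for each fixed z.
   Averaging over z in the unit ball and exchanging the integrals leaves, for
   each fixed M, the volume computed in [lebesgue_head2_le]. *)
Lemma prob_small_coord k p (G : T -> 'M[C]_k) (l : 'I_k) (t : R) : k = p.+1 ->
  0 <= t < 1 -> mx_cmeas G ->
  (forall U, U \is unitarymx ->
    P [set w | small_coord l t (cofac l (G w *m U))] =
    P [set w | small_coord l t (cofac l (G w))]) ->
  (P [set w | small_coord l t (cofac l (G w))] <= (p%:R * t)%:E)%E.
Proof.
move=> kp; subst k => t01 mG Ginv; set S := [set w | _].
pose M w := cofac l (G w).
have mM : mx_cmeas M by exact: cmeas_cofac.
pose D : set ((2 * p).+2.-tuple R * T) := [set q | (sqnorm q.1 <= 1 /\ 0 < sqnormc (M q.2)) /\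
  sqmod (((M q.2)^T *m cvec q.1) 0 0) <= t * sqnormc (M q.2) * sqnorm q.1].
have mM2 : measurable_fun setT (fun q : (2 * p).+2.-tuple R * T => sqnormc (M q.2)).
  have := measurable_sqnormc mM => h.
  exact: (measurableT_comp h measurable_snd).
have ms1 : measurable_fun setT (fun q : (2 * p).+2.-tuple R * T => sqnorm q.1).
  exact: (measurableT_comp (@measurable_sqnorm R _) measurable_fst).
have mD : measurable D.
  apply: measurableI.
    apply: measurableI; first by apply: measurable_le.
    by apply: measurable_lt.
  apply: measurable_le; last first.
    by apply: measurable_funM => //; apply: measurable_funM.
  apply: measurable_sqmod; apply: cmeas_mulmx => i j.
    rewrite (_ : (fun x => _) = fun q : (2 * p).+2.-tuple R * T => M q.2 j i); last first.
      by apply/funext => q; rewrite mxE.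
    have [mr mi] := mM j i; split.
      exact: (measurableT_comp mr measurable_snd).
    exact: (measurableT_comp mi measurable_snd).
  have [mr mi] := @cmeas_cvec R p i j; split.
    exact: (measurableT_comp mr measurable_fst).
  exact: (measurableT_comp mi measurable_fst).
have mball := @measurable_unit_ball R (2 * p).+2.
have Dx v : sqnorm v <= 1 -> (P S <= P (xsection D v))%E.
  (* As [v] is [c] times row [l] of [U], its pairing with [M w] is [c] times entry [l] of
     [U *m M w], the cofactor vector after rotation up to a phase. Only an inclusion is claimed, so
     [c = 0] is no exception. *)
  move=> v1; have [U [c [uU zE]]] := unitary_row l (cvec v)^T.
  have uU' : U^t* \is unitarymx by rewrite trmxC_unitary.
  rewrite -(Ginv _ uU'); apply: le_measure; rewrite ?inE.
  - apply: measurableI.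
      apply: measurable_lt => //; apply: measurable_sqnormc; apply: cmeas_cofac.
      by apply: cmeas_mulmx => // i j; exact: cmeas_cst.
    have mC : mx_cmeas (fun w => cofac l (G w *m U^t*)).
      by apply: cmeas_cofac; apply: cmeas_mulmx => // i j; exact: cmeas_cst.
    apply: measurable_le; first by apply: measurable_sqmod; exact: mC.
    by apply: measurable_funM => //; exact: measurable_sqnormc.
  - exact: measurable_xsection.
  move=> w; rewrite /small_coord /xsection /= inE /D /=.
  have E : cofac l (G w *m U^t*) = \det (U^t*) *: (U *m M w).
    rewrite -[LHS]mul1mx -(unitarymxP uU) -mulmxA cofac_mulmx.
    by rewrite -scalemxAr.
  rewrite E sqnormcZ sqmod_det_unitary// mul1r sqnormc_unitary// mxE sqmodM sqmod_det_unitary// mul1r.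
  move=> [M0 h]; split=> //.
  have -> : sqnorm v = sqmod c.
    rewrite -sqnormc_cvec -[cvec v]trmxK zE linearZ sqnormcZ sqnormc_row_unitary// mulr1//.
  have -> : ((M w)^T *m cvec v) 0 0 = c * (U *m M w) l 0.
    rewrite -[cvec v]trmxK -trmx_mul zE mxE -scalemxAl -row_mul !mxE//.
  by rewrite sqmodM mulrC ler_wpM2r ?sqmod_ge0.
have Dy w : (leb _ (ysection D w) <= (p%:R * t)%:E * leb _ (@unit_ball R (2 * p).+2))%E.
  have [M0|M0] := ltP 0 (sqnormc (M w)); last first.
    rewrite (_ : ysection D w = set0); last first.
      apply/seteqP; split=> v //; rewrite /ysection/= inE /D/= ltNge M0.
      by move=> [[]].
    rewrite measure0 mule_ge0// lee_fin mulr_ge0//.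
    by case/andP: t01.
  rewrite (_ : ysection D w = [set v : (2 * p).+2.-tuple R | sqnorm v <= 1 /\
      sqmod (((M w)^T *m cvec v) 0 0) <= t * sqnormc (M w)^T^T * sqnorm v]); last first.
    apply/seteqP; split=> v; rewrite /ysection/= inE /D/= trmxK; first by move=> [[]].
    by move=> [].
  by rewrite lebesgue_rotation ?trmxK//; exact: lebesgue_head2_le.
have DE : (\int[leb _]_v P (xsection D v) = \int[P]_w leb _ (ysection D w))%E.
  rewrite -[LHS]/((leb _ \x P)%E D).
  rewrite (product_measure_unique (m' := (leb _ \x^ P)%E))//.
  by move=> B C mB mC; exact: product_measure2E.
set beta := leb _ (@unit_ball R (2 * p).+2) in Dy.
have bfin : beta \is a fin_num.
  by rewrite ge0_fin_numE ?measure_ge0// lebesgue_unit_ball_lty.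
have b0 : (0 < beta)%E := lebesgue_unit_ball_gt0 R (2 * p).+2.
have H1 : (P S * beta <= \int[leb _]_v P (xsection D v))%E.
  rewrite -integral_cst//.
  rewrite integral_mkcond; apply: ge0_le_integral => //.
  - by move=> v _; rewrite patchE; case: ifP.
  - apply/(measurable_restrictT _ _).1 => //.
  - by apply: measurable_fun_xsection.
  - move=> v _; rewrite patchE; case: ifP => [vb|_]; last exact: measure_ge0.
    exact: Dx (set_mem vb).
have H2 : (\int[P]_w leb _ (ysection D w) <= (p%:R * t)%:E * beta)%E.
  apply: (@le_trans _ _ (\int[P]_w cst ((p%:R * t)%:E * beta) w)%E).
    apply: ge0_le_integral => //.
    - exact: measurable_fun_ysection.
  rewrite integral_cst// [X in (_ * X)%E](_ : _ = 1%E) ?mule1//.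
  exact: probability_setT.
rewrite DE in H1; have := le_trans H1 H2.
by rewrite lee_pmul2r.
Qed.

End RandomCofactors.

(** * Singular spaces *)

Section RationalConjugation.
Variable R : realType.
Local Notation C := R[i].

(** [conj_ratfun] acts on a chosen representative [a / b], of which only [a = b * q] is known; this
    relation survives conjugation. *)
Lemma conj_ratfun_tofrac (q : {poly C}) :
  conj_ratfun (tofrac q) = tofrac (map_poly Num.conj q).
Proof.
rewrite /conj_ratfun.
have : (frac (repr (tofrac q))).1 = (frac (repr (tofrac q))).2 * q.
  have := FracField.equivf_l (Ratio q 1).
  rewrite !numden_Ratio ?oner_neq0// mulr1.
  by unlock tofrac.
have := denom_ratioP (repr (tofrac q)).
case: (frac (repr (tofrac q))) => a b /= b0 ->.
rewrite rmorphM rmorphM/= mulrC mulKf//.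
by rewrite tofrac_eq0 map_poly_eq0.
Qed.

End RationalConjugation.

Section SingularSpaces.
Variable R : realType.
Local Notation C := R[i].

Lemma mpevalM m n p (M : 'M[{poly C}]_(m, n)) (N : 'M[{poly C}]_(n, p)) lam :
  mpeval (M *m N) lam = mpeval M lam *m mpeval N lam.
Proof. by rewrite /mpeval -[map_mx _ _]/(map_mx (horner_eval lam) _) map_mxM. Qed.

Lemma mpderivM m n p (M : 'M[{poly C}]_(m, n)) (N : 'M[{poly C}]_(n, p)) :
  mpderiv (M *m N) = mpderiv M *m N + M *m mpderiv N.
Proof.
apply/matrixP => i j; rewrite !mxE raddf_sum -big_split.
by apply: eq_bigr => l _; rewrite /= derivM !mxE.
Qed.

Lemma mpevalD m n (M N : 'M[{poly C}]_(m, n)) lam :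
  mpeval (M + N) lam = mpeval M lam + mpeval N lam.
Proof. by apply/matrixP => i j; rewrite !mxE hornerD. Qed.

Lemma mpeval0 m n lam : mpeval (0 : 'M[{poly C}]_(m, n)) lam = 0.
Proof. by apply/matrixP => i j; rewrite !mxE horner0. Qed.

Lemma mpfrac_eq0 m n (M : 'M[{poly C}]_(m, n)) : mpfrac M = 0 -> M = 0.
Proof.
move=> M0; apply/matrixP => i j; move/matrixP/(_ i j) : M0.
by rewrite !mxE => /eqP; rewrite tofrac_eq0 => /eqP.
Qed.

Lemma mpderiv_mulmx0 m n p (M : 'M[{poly C}]_(m, n)) (N : 'M[{poly C}]_(n, p)) lam :
  M *m N = 0 ->
  mpeval (mpderiv M) lam *m mpeval N lam = - (mpeval M lam *m mpeval (mpderiv N) lam).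
Proof.
move=> MN; apply/eqP; rewrite -subr_eq0 opprK -!mpevalM -mpevalD -mpderivM MN.
by rewrite /mpderiv map_mx0 mpeval0.
Qed.

Lemma col_basis_col (F : fieldType) n k (V : set 'cV[F]_n) (Z : 'M[F]_(n, k)) j :
  col_basis V Z -> V (col j Z).
Proof. by move=> [_ <-]; exists (delta_mx j 0) => //; rewrite colE. Qed.

(** From [Q *m Z = 0], the product rule trades the derivative of [Q] for that of [Z], leaving a
    factor [Q] which [w] annihilates at [lam]. *)
Lemma ker_at_deriv n (Q : 'M[{poly C}]_n) lam (w : 'rV[C]_n) (v : 'cV[C]_n) :
  w *m mpeval Q lam = 0 -> ker_at Q lam v ->
  w *m mpeval (mpderiv Q) lam *m v = 0.
Proof.
move=> wQ [k [Z [[Zbasis _] [c _ <-]]]].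
have QZ : Q *m Z = 0.
  apply: mpfrac_eq0; apply/matrixP => i j.
  have /matrixP/(_ i 0) := col_basis_col j Zbasis.
  rewrite colE mulmxA -colE !mxE => <-; rewrite rmorph_sum; apply: eq_bigr => a _.
  by rewrite rmorphM !mxE.
rewrite mulmxA -(mulmxA w) (mpderiv_mulmx0 _ QZ) mulmxN mulmxA wQ mul0mx oppr0.
by rewrite mul0mx.
Qed.

Lemma lker_at_deriv n (Q : 'M[{poly C}]_n) lam (v u : 'cV[C]_n) :
  mpeval Q lam *m u = 0 -> lker_at Q lam v ->
  v^t* *m mpeval (mpderiv Q) lam *m u = 0.
Proof.
move=> Qu [k [Z [[Zbasis _] [c _ <-]]]].
(* A polynomial in [lam] whose value is the conjugate transpose of [Z] at the conjugate point, so
   that the product rule applies on the left as well. *)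
pose Zc := (map_mx (map_poly Num.conj) Z)^T.
have ZQ : Zc *m Q = 0.
  apply: mpfrac_eq0; apply/matrixP => i j.
  have /matrixP/(_ 0 j) := col_basis_col i Zbasis.
  rewrite !mxE => <-; rewrite rmorph_sum; apply: eq_bigr => a _.
  by rewrite rmorphM !mxE conj_ratfun_tofrac.
have -> : (mpeval Z (Num.conj lam) *m c)^t* = c^t* *m mpeval Zc lam.
  rewrite trmx_mul map_mxM; congr (_ *m _); apply/matrixP => i j; rewrite !mxE.
  by rewrite -horner_map /= conjCK.
rewrite -(mulmxA _ (mpeval Zc lam)).
have := mpderiv_mulmx0 lam ZQ => /(congr1 -%R); rewrite opprK => <-.
by rewrite mulmxN mulNmx -!mulmxA Qu !mulmx0 oppr0.
Qed.

End SingularSpaces.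

Section KernelCoordinates.
Variables (R : realType) (k : nat).
Local Notation C := R[i].

Lemma sqmod_cofac_kernel (l : 'I_k) (G : 'M[C]_k) (b : 'cV[C]_k) :
  (forall i, i != l -> (G *m b) i 0 = 0) -> sqnormc b = 1 ->
  sqmod (cofac l G l 0) = sqmod (b l 0) * sqnormc (cofac l G).
Proof.
(* Pairing with the conjugate transpose of the unit vector [b] gives coefficient 1, so the cofactor
   vector is an explicit multiple of [b]. *)
move=> Gb b1; have := cofac_kernel (b^t*) Gb.
rewrite -sqnormcC b1 scale1r => <-.
by rewrite sqnormcZ b1 mulr1 mxE sqmodM mulrC.
Qed.

Lemma sqnormc_hnorm (b : 'cV[C]_k) : hnorm b = 1 -> sqnormc b = 1.
Proof.
rewrite /hnorm (eq_bigr (fun i => sqmod (b i 0))); last first.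
  by move=> i _; rewrite sqmod_normc.
rewrite -/(sqnormc b) => h.
by rewrite -[LHS]sqr_sqrtr ?sqnormc_ge0// h expr1n.
Qed.

End KernelCoordinates.

(** * The random perturbation *)

Section UnitaryExtension.
Variables (R : realType) (n k : nat).
Local Notation C := R[i].

(** [W] acts as [U] on the range of [Z] and as the identity on its orthogonal complement. It lifts a
    rotation of the compressed matrix to one of the full coefficients. *)
Lemma extend_unitary (Z : 'M[C]_(n, k)) (U : 'M[C]_k) :
  orthonormal_cols Z -> U \is unitarymx ->
  exists W : 'M[C]_n, [/\ W \is unitarymx, W *m Z = Z *m U & Z^t* *m W = U *m Z^t*].
Proof.
rewrite /orthonormal_cols => ZZ /unitarymxP UU.
pose Q := 1%:M - Z *m Z^t*.
have QZ : Q *m Z = 0 by rewrite mulmxBl mul1mx -mulmxA ZZ mulmx1 subrr.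
have ZQ : Z^t* *m Q = 0 by rewrite mulmxBr mulmx1 mulmxA ZZ mul1mx subrr.
have Qh : Q^t* = Q.
  by rewrite linearB/= map_mxB trmx1 map_mx1 trmx_mul map_mxM trmxCK.
have QE : Q = 1%:M - Z *m Z^t* by [].
clearbody Q; pose W := Z *m U *m Z^t* + Q.
exists W; split.
- have Wh : W^t* = Z *m U^t* *m Z^t* + Q.
    rewrite /W linearD/= map_mxD Qh trmx_mul map_mxM trmxCK trmx_mul map_mxM.
    by rewrite mulmxA.
  have A1 : Z *m U *m Z^t* *m (Z *m U^t* *m Z^t*) = Z *m Z^t*.
    rewrite -!mulmxA (mulmxA (Z^t*) Z) ZZ mul1mx (mulmxA U) UU mul1mx.
    by [].
  have A2 : Z *m U *m Z^t* *m Q = 0 by rewrite -mulmxA ZQ mulmx0.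
  have A3 : Q *m (Z *m U^t* *m Z^t*) = 0 by rewrite !mulmxA QZ !mul0mx.
  have A4 : Q *m Q = Q by rewrite {2}QE mulmxBr mulmx1 mulmxA QZ mul0mx subr0.
  apply/unitarymxP; rewrite Wh mulmxDl !mulmxDr A1 A2 A3 A4 addr0 add0r.
  by rewrite QE addrC subrK.
- by rewrite /W mulmxDl QZ addr0 -mulmxA ZZ mulmx1.
- by rewrite /W mulmxDr ZQ addr0 !mulmxA ZZ mul1mx.
Qed.

End UnitaryExtension.

Section Frobenius.
Variable R : realType.
Local Notation C := R[i].

Definition sqfrob m n (A : 'M[C]_(m, n)) : R := \sum_i \sum_j sqmod (A i j).

Lemma sqfrob_cols m n (A : 'M[C]_(m, n)) : sqfrob A = \sum_j sqnormc (col j A).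
Proof.
rewrite /sqfrob exchange_big; apply: eq_bigr => j _; apply: eq_bigr => i _.
by rewrite mxE.
Qed.

Lemma sqfrob_tr m n (A : 'M[C]_(m, n)) : sqfrob A^T = sqfrob A.
Proof.
rewrite /sqfrob exchange_big; apply: eq_bigr => j _; apply: eq_bigr => i _.
by rewrite mxE.
Qed.

Lemma sqfrob_unitaryl m n (W : 'M[C]_m) (A : 'M[C]_(m, n)) :
  W \is unitarymx -> sqfrob (W *m A) = sqfrob A.
Proof.
move=> uW; rewrite !sqfrob_cols; apply: eq_bigr => j _.
by rewrite colE -mulmxA -colE sqnormc_unitary.
Qed.

Lemma sqfrob_unitaryr m n (W : 'M[C]_n) (A : 'M[C]_(m, n)) :
  W \is unitarymx -> sqfrob (A *m W) = sqfrob A.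
Proof.
by move=> uW; rewrite -sqfrob_tr trmx_mul sqfrob_unitaryl ?trmx_unitary// sqfrob_tr.
Qed.

End Frobenius.

(** * Real coordinates of the coefficients and the compressed matrix *)

Section Coefficients.
Variables (R : realType) (m n : nat).
Local Notation C := R[i].
Local Notation leb d := (@lebesgue_tuple R d).
Local Notation tup := (#|Defs.coord m n|.-tuple R).

Definition unvec (v : tup) (i : 'I_m.+1) : 'M[C]_n :=
  \matrix_(j, k) Complex (tnth v (enum_rank ((i, k, j, true) : Defs.coord m n)))
                         (tnth v (enum_rank ((i, k, j, false) : Defs.coord m n))).

Lemma tnth_codom_tuple (D : finType) (g : D -> R) i :
  tnth (codom_tuple g) i = g (enum_val i).
Proof.
rewrite (tnth_nth (g (enum_val i))) /= /codom /image_mem (nth_map (enum_val i)).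
  by rewrite -enum_val_nth.
by rewrite -cardE.
Qed.

Lemma realvecK (E : 'I_m.+1 -> 'M[C]_n) : unvec (realvec E) = E.
Proof.
apply/funext => i; apply/matrixP => j k; rewrite mxE.
rewrite !tnth_codom_tuple !enum_rankK.
by case: (E i j k).
Qed.

Lemma unvecK v : realvec (unvec v) = v.
Proof.
apply: eq_from_tnth => i; rewrite tnth_codom_tuple.
rewrite -[in RHS](enum_valK i).
by case: (enum_val i) => [[[i' k] j] []]; rewrite mxE.
Qed.

Lemma unvec_linear a v w i :
  unvec [tuple a * tnth v j + tnth w j | j < _] i = a%:C%C *: unvec v i + unvec w i.
Proof.
apply/matrixP => j k; rewrite !mxE !tnth_mktuple.
by apply/eqP; rewrite eq_complex /= !mul0r subr0 addr0 !eqxx.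
Qed.

Lemma sum_prod (I J : finType) (F : I * J -> R) :
  \sum_p F p = \sum_i \sum_j F (i, j).
Proof. by rewrite pair_bigA; apply: eq_bigr => -[]. Qed.

Lemma sqnorm_realvec (E : 'I_m.+1 -> 'M[C]_n) : sqnorm (realvec E) = \sum_i sqfrob (E i).
Proof.
rewrite /sqnorm.
pose g (c : Defs.coord m n) := let: (i, k, j, re) := c in
  if re then complex.Re (E i j k) else complex.Im (E i j k).
rewrite (eq_bigr (fun i => g (enum_val i) ^+ 2)); last first.
  by move=> i _; rewrite tnth_codom_tuple.
transitivity (\sum_(c : Defs.coord m n) g c ^+ 2).
  by rewrite [RHS](big_enum_val (A := Defs.coord m n) (fun c => g c ^+ 2)).
rewrite !sum_prod /=.
apply: eq_bigr => i _; rewrite exchange_big; apply: eq_bigr => j _.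
apply: eq_bigr => k _; rewrite big_bool /=.
by rewrite /sqmod.
Qed.

Lemma cmeas_unvec i : mx_cmeas (fun v => unvec v i).
Proof.
move=> j k; split.
  rewrite (_ : (fun x => _) = fun v : tup => tnth v (enum_rank ((i, k, j, true) : Defs.coord m n))).
    exact: measurable_tnth.
  by apply/funext => v; rewrite mxE.
rewrite (_ : (fun x => _) = fun v : tup => tnth v (enum_rank ((i, k, j, false) : Defs.coord m n))).
  exact: measurable_tnth.
by apply/funext => v; rewrite mxE.
Qed.

(** One pair of factors for all coefficients commutes with evaluation at a point, and unitary
    factors preserve every Frobenius norm. *)
Definition bimul (W1 W2 : 'M[C]_n) (v : tup) : tup :=
  realvec (fun i => W1 *m unvec v i *m W2).

Lemma unvec_bimul W1 W2 v i : unvec (bimul W1 W2 v) i = W1 *m unvec v i *m W2.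
Proof. by rewrite /bimul realvecK. Qed.

Lemma linear_bimul W1 W2 : linear_tuple (bimul W1 W2).
Proof.
move=> a v w; apply: (can_inj unvecK); apply/funext => i.
rewrite unvec_bimul (unvec_linear a v w i) mulmxDr mulmxDl -scalemxAr -scalemxAl.
apply/esym/(etrans (unvec_linear a (bimul W1 W2 v) (bimul W1 W2 w) i)).
by rewrite (unvec_bimul _ _ v) (unvec_bimul _ _ w).
Qed.

Lemma sqnorm_bimul W1 W2 v : W1 \is unitarymx -> W2 \is unitarymx ->
  sqnorm (bimul W1 W2 v) = sqnorm v.
Proof.
move=> u1 u2; rewrite -[in RHS](unvecK v) !sqnorm_realvec; apply: eq_bigr => i _.
by rewrite (sqfrob_unitaryr _ u2) (sqfrob_unitaryl _ u1).
Qed.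

Lemma mpeval_matpoly (E : 'I_m.+1 -> 'M[C]_n) lam :
  mpeval (matpoly E) lam = \sum_(i < m.+1) lam ^+ i *: E i.
Proof.
apply/matrixP => j k; rewrite mxE /matpoly !summxE horner_sum.
by apply: eq_bigr => i _; rewrite !mxE hornerM hornerXn hornerC.
Qed.

Section Compression.
Variables (k : nat) (lam : C) (Xx Yy : 'M[C]_(n, k)).

Definition compress (v : tup) : 'M[C]_k :=
  Yy^t* *m mpeval (matpoly (unvec v)) lam *m Xx.

Lemma compress_linear a v w :
  compress [tuple a * tnth v j + tnth w j | j < _] =
  a%:C%C *: compress v + compress w.
Proof.
rewrite /compress !mpeval_matpoly.
rewrite scalemxAl scalemxAr -mulmxDl -mulmxDr; congr (_ *m _ *m _).
rewrite scaler_sumr -big_split; apply: eq_bigr => i _ /=.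
by rewrite unvec_linear scalerDr !scalerA mulrC.
Qed.

Lemma cmeas_compress : mx_cmeas compress.
Proof.
apply: cmeas_mulmx; last by move=> i j; exact: cmeas_cst.
apply: cmeas_mulmx; first by move=> i j; exact: cmeas_cst.
move=> i j.
rewrite (_ : (fun v => _) = fun v => \sum_(a < m.+1) lam ^+ a * unvec v a i j).
  apply: cmeas_sum => a; apply: cmeasM; first exact: cmeas_cst.
  exact: cmeas_unvec.
apply/funext => v; rewrite mpeval_matpoly summxE.
by apply: eq_bigr => a _; rewrite mxE.
Qed.

Lemma compress_bimul W1 W2 v :
  compress (bimul W1 W2 v) =
  Yy^t* *m W1 *m mpeval (matpoly (unvec v)) lam *m (W2 *m Xx).
Proof.
rewrite /compress (_ : mpeval _ _ = W1 *m mpeval (matpoly (unvec v)) lam *m W2).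
  by rewrite !mulmxA.
rewrite !mpeval_matpoly mulmx_sumr mulmx_suml; apply: eq_bigr => i _.
by rewrite unvec_bimul -scalemxAr -scalemxAl.
Qed.

End Compression.
End Coefficients.

Section UniformSphere.
Variables (R : realType) (d : nat) (disp : measure_display).
Variables (T : measurableType disp) (P : probability T R) (V : T -> d.-tuple R).
Hypothesis unifV : uniform_sphere P V.
Local Notation leb d := (@lebesgue_tuple R d).

Lemma measurable_linear_tuple (f : d.-tuple R -> d.-tuple R) A :
  linear_tuple f -> measurable A -> measurable [set v | A (f v)].
Proof.
move=> /linear_tuple_tmulmx[M ->] mA.
by apply: measurable_preimage_tuple => //; exact: measurable_tmulmx.
Qed.

Lemma uniform_sphere_isometry (f : d.-tuple R -> d.-tuple R) A :
  linear_tuple f -> (forall v, sqnorm (f v) = sqnorm v) -> measurable A ->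
  P [set w | A (f (V w))] = P [set w | A (V w)].
Proof.
move=> fl fiso mA; have [_ VP] := unifV.
rewrite -[LHS]/(P (V @^-1` [set v | A (f v)])) -[RHS]/(P (V @^-1` A)).
rewrite VP; last exact: measurable_linear_tuple.
by rewrite VP// lebesgue_cone_isometry.
Qed.

Lemma measurable_uniform_sphere A : measurable A -> measurable [set w | A (V w)].
Proof.
by move=> mA; rewrite -[X in measurable X]setTI; have [mV _] := unifV; exact: mV.
Qed.

(** The second hypothesis puts the cone over [Z] inside [Z], so a Lebesgue null set of this kind is
    null for the sphere. *)
Lemma uniform_sphere_null Z : measurable Z ->
  (forall (s : R) v, s != 0 -> Z [tuple s * tnth v i | i < d] -> Z v) ->
  leb d Z = 0%E -> P [set w | Z (V w)] = 0%E.
Proof.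
move=> mZ Zcone Z0; have [_ VP] := unifV.
rewrite -[LHS]/(P (V @^-1` Z)) VP//.
rewrite (_ : leb d (cone Z) = 0%E) ?mul0r//.
apply: (subset_measure0 (mu := leb d) (measurable_cone mZ) mZ _ Z0).
move=> v [/andP[v0 _]]; apply: Zcone.
by rewrite invr_neq0// gt_eqF.
Qed.

End UniformSphere.

(** * Unitary invariance and generic minors of the compressed perturbation *)

Section Compression.
Variables (R : realType) (m n k : nat) (lam : R[i]) (Xx Yy : 'M[R[i]]_(n, k)).
Local Notation C := R[i].
Local Notation leb d := (@lebesgue_tuple R d).
Hypothesis oX : orthonormal_cols Xx.
Hypothesis oY : orthonormal_cols Yy.
Local Notation cpr := (@compress R m n k lam Xx Yy).

Lemma horner_char_poly q (M : 'M[C]_q) (s : C) : (char_poly M).[s] = \det (s%:M - M).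
Proof.
rewrite -[LHS]/(horner_eval s _) /char_poly -det_map_mx; congr (\det _).
apply/matrixP => i j; rewrite !mxE /= /horner_eval hornerD hornerN hornerC.
by rewrite hornerMn hornerX.
Qed.

Lemma measure_root_real (q : {poly C}) : q != 0 ->
  @lebesgue_measure R [set s | q.[s%:C%C] = 0] = 0%E.
Proof.
move=> q0; apply: countable_lebesgue_measure0; apply: finite_set_countable.
have [rs qE] := closed_field_poly_normal q.
apply: (@sub_finite_set _ _ [set` map (@complex.Re R) rs]); last exact: finite_seq.
move=> s /=; rewrite qE hornerZ => /eqP.
rewrite mulf_eq0 lead_coef_eq0 (negPf q0)/= -rootE root_prod_XsubC => srs.
by rewrite -[s]/(complex.Re s%:C%C); apply: map_f.
Qed.

(** An inequality between real functions makes measurability immediate; [singular_minorE] gives the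
    algebraic meaning. *)
Definition singular_minor (l : 'I_k) : set (#|Defs.coord m n|.-tuple R) :=
  [set v | sqmod (cofac l (cpr v) l 0) <= 0].

Lemma singular_minorE l v : singular_minor l v <-> cofactor (cpr v) l l = 0.
Proof.
rewrite /singular_minor /= mxE; split=> [|->]; last by rewrite /sqmod /= expr0n addr0.
move=> h; have /eqP : sqmod (cofactor (cpr v) l l) = 0.
  by apply/eqP; rewrite eq_le h sqmod_ge0.
rewrite /sqmod paddr_eq0 ?sqr_ge0// !sqrf_eq0.
by case: (cofactor _ _ _) => x y /= /andP[/eqP -> /eqP ->].
Qed.

Lemma measurable_singular_minor l : measurable (singular_minor l).
Proof.
apply: measurable_le => //; apply: measurable_sqmod.
by apply: cmeas_cofac; exact: cmeas_compress.
Qed.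

(* Along the direction c, whose compression is the identity matrix, the minor is
   a characteristic polynomial in the parameter. *)
Lemma lebesgue_singular_minor l : leb _ (singular_minor l) = 0%E.
Proof.
(* Only the constant coefficient moves, with weight [lam ^+ 0 = 1] even at [lam = 0]; orthonormality
   of the columns of [Xx] and [Yy] makes its compression the identity. *)
pose c := @realvec R m n (fun i => if i == ord0 then Yy *m Xx^t* else 0).
have cE : cpr c = 1%:M.
  rewrite /compress realvecK mpeval_matpoly (bigD1 ord0)//= big1 ?addr0; last first.
    by move=> i /negPf ->; rewrite scaler0.
  by rewrite expr0 scale1r !mulmxA oY mul1mx oX.
apply: (lebesgue_tuple_lines0 (c := c)); first exact: measurable_singular_minor.
move=> v; pose N := row' l (col' l (cpr v)).
rewrite -(measure_root_real (q := char_poly (- N))); last first.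
  by rewrite monic_neq0 ?char_poly_monic.
congr (lebesgue_measure _); apply/funext => s /=; apply/propext.
rewrite singular_minorE horner_char_poly opprK.
have -> : tadd v [tuple s * tnth c i | i < _] =
    [tuple s * tnth c i + tnth v i | i < #|Defs.coord m n|].
  by apply: eq_from_tnth => i; rewrite !tnth_mktuple addrC.
rewrite compress_linear cE /cofactor -signr_odd oddD addbb expr0 mul1r.
rewrite (_ : row' l _ = s%:C%C%:M + N)//.
apply/matrixP => i j; rewrite !mxE (inj_eq lift_inj).
by case: (i == j); rewrite ?mulr1 ?mulr0.
Qed.

Lemma singular_minor_cone l (s : R) v : s != 0 ->
  singular_minor l [tuple s * tnth v i | i < _] -> singular_minor l v.
Proof.
move=> s0 /singular_minorE h; apply/singular_minorE; move: h.
have -> : [tuple s * tnth v i | i < _] =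
    [tuple s * tnth v i + tnth ([tuple 0 | i < _] : #|Defs.coord m n|.-tuple R) i | i < #|Defs.coord m n|].
  by apply: eq_from_tnth => i; rewrite !tnth_mktuple addr0.
rewrite compress_linear (_ : cpr [tuple 0 | i < _] = 0) ?addr0; last first.
  have := compress_linear lam Xx Yy (-1) v v.
  rewrite rmorphN1 scaleN1r addNr => <-; congr (compress _ _ _ _).
  by apply: eq_from_tnth => i; rewrite !tnth_mktuple mulN1r addNr.
rewrite cofactorZ => /eqP; rewrite mulf_eq0 expf_eq0 => /orP[/andP[_]|/eqP//].
by rewrite eq_complex /= (negPf s0).
Qed.

Section Random.
Variables (disp : measure_display) (T : measurableType disp).
Variables (P : probability T R) (E : T -> 'I_m.+1 -> 'M[C]_n).
Hypothesis unifE : uniform_sphere P (fun w => realvec (E w)).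

Let G w := Yy^t* *m mpeval (matpoly (E w)) lam *m Xx.

Lemma compress_realvec w : cpr (realvec (E w)) = G w.
Proof. by rewrite /compress realvecK. Qed.

Lemma eq_prob (A B : set T) : (forall w, A w = B w) -> P A = P B.
Proof. by move=> AB; rewrite (_ : A = B)//; apply/funext. Qed.

Lemma prob_compress_unitary (B : set 'M[C]_k) (U1 U2 : 'M[C]_k) :
  U1 \is unitarymx -> U2 \is unitarymx ->
  measurable [set v | B (cpr v)] ->
  P [set w | B (U1 *m G w *m U2)] = P [set w | B (G w)].
Proof.
move=> u1 u2 mB.
have [W1 [uW1 _ W1Y]] := extend_unitary oY u1.
have [W2 [uW2 W2X _]] := extend_unitary oX u2.
have PE := uniform_sphere_isometry unifE (@linear_bimul R m n W1 W2)
  (fun v => sqnorm_bimul v uW1 uW2) mB.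
apply: etrans (etrans PE _); apply: eq_prob => w /=.
  by rewrite compress_bimul realvecK W1Y W2X /G !mulmxA.
by rewrite compress_realvec.
Qed.

Lemma cmeas_tr_conj (d : measure_display) (S : measurableType d) a b (A : S -> 'M[C]_(a, b)) :
  mx_cmeas A -> mx_cmeas (fun x => (A x)^t*).
Proof.
move=> mA i j; have [mr mi] := mA j i; split.
  rewrite (_ : (fun x => _) = fun x => complex.Re (A x j i))//.
  by apply/funext => x; rewrite !mxE; case: (A x j i).
rewrite (_ : (fun x => _) = fun x => - complex.Im (A x j i)).
  exact: measurable_funN.
by apply/funext => x; rewrite !mxE; case: (A x j i).
Qed.

Lemma measurable_small_coord (d : measure_display) (S : measurableType d) l t
    (M : S -> 'cV[C]_k) :
  mx_cmeas M -> measurable [set x | small_coord l t (M x)].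
Proof.
move=> mM; apply: measurableI.
  by apply: measurable_lt => //; exact: measurable_sqnormc.
apply: measurable_le; first by apply: measurable_sqmod; exact: mM.
by apply: measurable_funM => //; exact: measurable_sqnormc.
Qed.

Lemma mx_cmeas_comp (f : #|Defs.coord m n|.-tuple R -> 'M[C]_k) :
  mx_cmeas f -> mx_cmeas (fun w => f (realvec (E w))).
Proof.
move=> mf i j; have [mr mi] := mf i j; have [mV _] := unifE; split.
  exact: (measurableT_comp mr mV).
exact: (measurableT_comp mi mV).
Qed.

Lemma prob_small_coord_right p l t : k = p.+1 -> 0 <= t < 1 ->
  (P [set w | small_coord l t (cofac l (G w))] <= (p%:R * t)%:E)%E.
Proof.
move=> kp t01.
have mC := @cmeas_compress R m n k lam Xx Yy.
apply: (prob_small_coord kp t01).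
  rewrite (_ : G = fun w => cpr (realvec (E w))); first exact: mx_cmeas_comp.
  by apply/funext => w; rewrite compress_realvec.
move=> U uU.
have u1 : (1%:M : 'M[C]_k) \is unitarymx.
  by apply/unitarymxP; rewrite mul1mx trmx1 map_mx1.
apply: etrans (prob_compress_unitary (B := [set M | small_coord l t (cofac l M)]) u1 uU _).
  by apply: eq_prob => w /=; rewrite mul1mx.
apply: measurable_small_coord; exact: cmeas_cofac.
Qed.

(** Multiplying the conjugate transpose of [G w] by [U] on the right amounts to multiplying [G w] by
    the conjugate transpose of [U] on the left, so the two-sided invariance covers this case. *)
Lemma prob_small_coord_left p l t : k = p.+1 -> 0 <= t < 1 ->
  (P [set w | small_coord l t (cofac l ((G w)^t*))] <= (p%:R * t)%:E)%E.
Proof.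
move=> kp t01.
have mC := cmeas_tr_conj (@cmeas_compress R m n k lam Xx Yy).
apply: (prob_small_coord (G := fun w => (G w)^t*) kp t01).
  rewrite (_ : (fun w => (G w)^t*) = fun w => (cpr (realvec (E w)))^t*).
    exact: (mx_cmeas_comp mC).
  by apply/funext => w; rewrite compress_realvec.
move=> U uU.
have u1 : (1%:M : 'M[C]_k) \is unitarymx.
  by apply/unitarymxP; rewrite mul1mx trmx1 map_mx1.
have uU' : U^t* \is unitarymx by rewrite trmxC_unitary.
apply: etrans (prob_compress_unitary (B := [set M | small_coord l t (cofac l (M^t*))]) uU' u1 _).
  by apply: eq_prob => w /=; rewrite mulmx1 [(U^t* *m _)^T]trmx_mul map_mxM trmxCK.
apply: measurable_small_coord; exact: cmeas_cofac.
Qed.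

Lemma prob_singular_minor l : P [set w | singular_minor l (realvec (E w))] = 0%E.
Proof.
apply: (uniform_sphere_null unifE).
- exact: measurable_singular_minor.
- exact: singular_minor_cone.
- exact: lebesgue_singular_minor.
Qed.

End Random.
End Compression.

(** * The bound *)

Section CompressedDerivative.
Variables (R : realType) (n q : nat) (Q : 'M[{poly R[i]}]_n) (lam : R[i]).
Local Notation C := R[i].
Variables (X Y : 'M[C]_(n, q)) (x y : 'cV[C]_n).
Local Notation Xx := (row_mx X x).
Local Notation Yy := (row_mx Y y).
Local Notation l := (rshift q ord0).
Hypothesis kerX : col_basis [set v | mpeval Q lam *m v = 0] Xx.
Hypothesis kerY : col_basis [set v | (mpeval Q lam)^t* *m v = 0] Yy.
Hypothesis singX : col_basis (ker_at Q lam) X.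
Hypothesis singY : col_basis (lker_at Q lam) Y.

Lemma compressed_derivative :
  Yy^t* *m mpeval (mpderiv Q) lam *m Xx =
  (y^t* *m mpeval (mpderiv Q) lam *m x) 0 0 *: delta_mx l l.
Proof.
have QX j : mpeval Q lam *m col j Xx = 0 by exact: (col_basis_col j kerX).
have YQ : Yy^t* *m mpeval Q lam = 0.
  rewrite -[mpeval Q lam]trmxCK -map_mxM -trmx_mul.
  rewrite (_ : _ *m Yy = 0) ?trmx0 ?map_mx0//.
  apply/matrixP => i j; have /matrixP/(_ i 0) := col_basis_col j kerY.
  by rewrite colE mulmxA -colE !mxE.
have entry i j : (Yy^t* *m mpeval (mpderiv Q) lam *m Xx) i j =
    ((col i Yy)^t* *m mpeval (mpderiv Q) lam *m col j Xx) 0 0.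
  rewrite tr_col map_row -row_mul [LHS]mxE [RHS]mxE; apply: eq_bigr => c _.
  by rewrite [row _ _ _ _]mxE [col _ _ _ _]mxE.
apply/matrixP => i j; rewrite entry [RHS]mxE [X in _ * X]mxE.
(* Columns from [X] vanish against every row, all columns of [Yy] being left null vectors at [lam];
   for the column [x] the rows from [Y] vanish symmetrically, which leaves the corner. *)
case: (split_ordP j) => j' ->; last first.
  case: (split_ordP i) => i' ->; last first.
    have col0 (z : 'cV[C]_n) : col 0 z = z by apply/colP => ?; rewrite mxE.
    by rewrite !ord1 !eqxx mulr1 !colKr !col0.
  rewrite (_ : (lshift 1 i' == l) = false) ?mulr0; last first.
    by apply/eqP => /(congr1 val) /= h; have := ltn_ord i'; rewrite h addn0 ltnn.
  by rewrite colKl (lker_at_deriv (QX _) (col_basis_col i' singY)) mxE.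
rewrite (_ : (lshift 1 j' == l) = false) ?andbF ?mulr0; last first.
  by apply/eqP => /(congr1 val) /= h; have := ltn_ord j'; rewrite h addn0 ltnn.
have iYQ : (col i Yy)^t* *m mpeval Q lam = 0.
  by rewrite tr_col map_row -row_mul YQ row0.
by rewrite colKl (ker_at_deriv iYQ (col_basis_col j' singX)) mxE.
Qed.

End CompressedDerivative.

Lemma mulmx_delta_mx (F : comNzRingType) k (a : 'rV[F]_k) (b : 'cV[F]_k) (h : F) l :
  (a *m (h *: delta_mx l l) *m b) 0 0 = h * (a 0 l * b l 0).
Proof.
rewrite -scalemxAr -scalemxAl mxE; congr (_ * _).
rewrite -(mul_delta_mx (0 : 'I_1)) mulmxA -colE -mulmxA -rowE mxE big_ord1.
by rewrite !mxE.
Qed.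

(** The added term changes row [l] only, so the other rows of [G] annihilate [b] for every [c]: the
    eigenvalue drops out. The nonzero minor is an entry of the cofactor vector and makes it
    nonzero. *)
Lemma pencil_kernel_coord (R : realType) k (l : 'I_k) (t : R) (G : 'M[R[i]]_k)
    (c : R[i]) (b : 'cV[R[i]]_k) :
  (G + c *: delta_mx l l) *m b = 0 -> sqnormc b = 1 ->
  cofactor G l l != 0 -> sqmod (b l 0) < t -> small_coord l t (cofac l G).
Proof.
move=> Gb b1 Gll bt.
have M0 : 0 < sqnormc (cofac l G).
  rewrite lt_neqAle sqnormc_ge0 andbT eq_sym sqnormc_eq0; apply: contra Gll => /eqP/colP/(_ l).
  by rewrite !mxE => ->.
have bG i : i != l -> (G *m b) i 0 = 0.
  move=> il; move/colP/(_ i): Gb; rewrite mulmxDl mxE [RHS]mxE => <-.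
  rewrite -scalemxAl -(mul_delta_mx (0 : 'I_1)) -mulmxA [X in _ = _ + X]mxE.
  by rewrite [X in _ = _ + _ * X]mxE big_ord1 [delta_mx _ _ i 0]mxE (negPf il) mul0r mulr0 addr0.
by split=> //; rewrite (sqmod_cofac_kernel bG b1) ler_pM2r// ltW.
Qed.

Lemma measure_cover2_null (R : realType) d (T : measurableType d)
    (mu : {measure set T -> \bar R}) (A S1 S2 Z N : set T) :
  measurable A -> measurable S1 -> measurable S2 -> measurable Z ->
  measurable N -> mu Z = 0%E -> mu N = 0%E ->
  A `<=` (S1 `|` S2) `|` (Z `|` N) -> (mu A <= mu S1 + mu S2)%E.
Proof.
move=> mA mS1 mS2 mZ mN Z0 N0 sub.
have mS := measurableU _ _ mS1 mS2; have mZN := measurableU _ _ mZ mN.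
apply: (@le_trans _ _ (mu ((S1 `|` S2) `|` (Z `|` N)))).
  by apply: le_measure => //; rewrite inE//; exact: measurableU.
apply: (le_trans (measureU2 mu mS mZN)).
by rewrite [X in (_ + X)%E](null_set_setU mZ mN Z0 N0) adde0; exact: measureU2.
Qed.

Theorem proposition4p3 (R : realType) (m n r : nat) (A : 'I_m.+1 -> 'M[R[i]]_n)
    (lam0 : R[i]) (X Y : 'M[R[i]]_(n, n - r)) (x y : 'cV[R[i]]_n)
    (disp : measure_display) (T : measurableType disp) (P : probability T R)
    (E : T -> 'I_m.+1 -> 'M[R[i]]_n)
    (zeta : T -> R[i]) (a b : T -> 'cV[R[i]]_(n - r + 1)) :
  let Q := matpoly A in
  let Xx := row_mx X x in
  let Yy := row_mx Y y in
  let G w := Yy^t* *m mpeval (matpoly (E w)) lam0 *m Xx in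
  let H := Yy^t* *m mpeval (mpderiv Q) lam0 *m Xx in
  let gammabar w := gammaP A lam0 (Yy *m a w) (Xx *m b w) in
  normal_rank Q r -> (r < n)%N ->
  simple_eigenvalue Q lam0 ->
  orthonormal_cols Xx -> orthonormal_cols Yy ->
  col_basis [set v | mpeval Q lam0 *m v = 0] Xx ->
  col_basis [set v | (mpeval Q lam0)^t* *m v = 0] Yy ->
  col_basis (ker_at Q lam0) X ->
  col_basis (lker_at Q lam0) Y ->
  uniform_sphere P (fun w => realvec (E w)) ->
  {ae P, forall w, unit_eigenvectors (G w) H (zeta w) (a w) (b w)} ->
  measurable_fun setT gammabar ->
  forall t : R, 0 < t <= 1 ->
    (P [set w | gammabar w < gammaP A lam0 y x * t]%R
      <= (2 * t * (n - r)%:R)%:E)%E.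
Proof.
move=> Q Xx Yy G H gammabar _ rn _ oX oY kX kY sX sY unifE eigE mgam t /andP[t0 t1].
have mS : measurable [set w | gammabar w < gammaP A lam0 y x * t].
  by apply: measurable_lt.
have q0 : (0 < n - r)%N by rewrite subn_gt0.
(* At [t = 1] the bound is at least 1; the volume computation divides by [1 - t] and needs
   [t < 1]. *)
have [t1'|t1'] := eqVneq t 1.
  apply: (@le_trans _ _ 1%E); first exact: probability_le1.
  by rewrite lee_fin t1' mulr1 -natrM ler1n muln_gt0.
have t01 : 0 <= t < 1 by rewrite ltW// lt_neqAle t1' t1.
pose l : 'I_(n - r + 1) := rshift (n - r) ord0.
pose h := (y^t* *m mpeval (mpderiv Q) lam0 *m x) 0 0.
have HE : H = h *: delta_mx l l by exact: compressed_derivative kX kY sX sY.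
pose s := (Num.sqrt (\sum_(j < m.+1) Normc.normc lam0 ^+ (2 * j)))^-1.
have s0 : 0 <= s by rewrite invr_ge0 sqrtr_ge0.
have gE w : gammabar w = gammaP A lam0 y x *
    (Normc.normc (a w l 0) * Normc.normc (b w l 0)).
  rewrite /gammabar /gammaP -/Q -/s -/h.
  rewrite (_ : (_ *m mpeval _ _ *m _) 0 0 = h * (Num.conj (a w l 0) * b w l 0)).
    rewrite !Normc.normcM mulrAC; congr (_ * _ * _).
    by congr (_ * _); case: (a w l 0) => u v; rewrite /Normc.normc /= sqrrN.
  rewrite trmx_mul map_mxM -!mulmxA (mulmxA (Yy^t*)) (mulmxA (Yy^t* *m _)) -/H HE mulmxA.
  by rewrite mulmx_delta_mx !mxE.
have g0 : 0 <= gammaP A lam0 y x.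
  rewrite mulr_ge0// /Normc.normc; case: (_ 0 0) => u v; exact: sqrtr_ge0.
have n0 (z : R[i]) : 0 <= Normc.normc z by case: z => u v; exact: sqrtr_ge0.
have kp : (n - r + 1 = (n - r).+1)%N by rewrite addn1.
pose S1 := [set w | small_coord l t (cofac l (G w))].
pose S2 := [set w | small_coord l t (cofac l ((G w)^t*))].
pose Z := [set w | singular_minor lam0 Xx Yy l (realvec (E w))].
have [N [mN PN NE]] := eigE.
have mC := @cmeas_compress R m n _ lam0 Xx Yy.
have mG : mx_cmeas G.
  rewrite (_ : G = fun w => compress lam0 Xx Yy (realvec (E w))).
    exact: (mx_cmeas_comp unifE mC).
  by apply/funext => w; rewrite compress_realvec.
have mS1 : measurable S1 by apply: measurable_small_coord; exact: cmeas_cofac.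
have mS2 : measurable S2.
  by apply: measurable_small_coord; apply: cmeas_cofac; exact: cmeas_tr_conj.
have mZ : measurable Z.
  apply: (measurable_uniform_sphere unifE); exact: measurable_singular_minor.
have sub : [set w | gammabar w < gammaP A lam0 y x * t] `<=` (S1 `|` S2) `|` (Z `|` N).
  move=> w; rewrite /= gE => gw.
  have [Nw|Nw] := pselect (N w); first by right; right.
  have [Zw|Zw] := pselect (Z w); first by right; left.
  left.
  have Gll : cofactor (G w) l l != 0.
    apply/eqP => G0; apply: Zw; apply/singular_minorE.
    by rewrite compress_realvec.
  have [_ aG Gb a1 b1] : unit_eigenvectors (G w) H (zeta w) (a w) (b w).
    by apply: contrapT => nE; apply: Nw; exact: NE.
  have ab : Normc.normc (a w l 0) * Normc.normc (b w l 0) < t.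
    rewrite ltNge; apply/negP => tab; move: gw; rewrite ltNge => /negP; apply.
    by rewrite ler_wpM2l.
  have [bt|tb] := ltP (sqmod (b w l 0)) t.
    left; apply: (pencil_kernel_coord (c := zeta w * h) _ (sqnormc_hnorm b1) Gll bt).
    by rewrite -scalerA -HE.
  (* Conjugate transposition turns the left eigenvector equation into a kernel equation, again
     perturbed in the entry [(l, l)] only. *)
  right; apply: (pencil_kernel_coord (c := Num.conj (zeta w * h)) _ (sqnormc_hnorm a1)).
  - move: aG => /(congr1 (fun M => M^t*)); rewrite trmx_mul map_mxM trmxCK trmx0 map_mx0.
    rewrite linearD/= map_mxD HE scalerA linearZ/= map_mxZ trmx_delta => <-.
    by congr ((_ + _ *: _) *m _); apply/matrixP => i j; rewrite !mxE rmorph_nat.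
  - rewrite (_ : cofactor _ _ _ = Num.conj (cofactor (G w) l l)) ?conjC_eq0//.
    rewrite /cofactor rmorphM rmorphXn rmorphN1 -det_map_mx -[in RHS]det_tr; congr (_ * \det _).
    by apply/matrixP => i j; rewrite !mxE.
  (* With both squared moduli at least [t], their product would be at least [t ^+ 2], against
     [ab]. *)
  rewrite ltNge; apply/negP => ta; move: ab; rewrite ltNge => /negP; apply.
  rewrite -(ler_pXn2r (n := 2)) ?nnegrE ?mulr_ge0//; last exact: ltW.
  by rewrite exprMn -!sqmod_normc expr2 ler_pM// ltW.
have PS1 := prob_small_coord_right lam0 oX oY unifE l kp t01.
have PS2 := prob_small_coord_left lam0 oX oY unifE l kp t01.
have PZ := prob_singular_minor lam0 oX oY unifE l.
apply: (le_trans (measure_cover2_null mS mS1 mS2 mZ mN PZ PN sub)).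
apply: (le_trans (leeD PS1 PS2)).
rewrite -EFinD lee_fin le_eqVlt; apply/orP; left; apply/eqP; ring.
Qed.
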